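(* Let $\mathscr{A}$ be a von Neumann algebra and $\mathscr{B}$ be a unital $C^*$-algebra. Then a (not necessarily linear) map $\Phi:\mathscr{A}\to\mathscr{B}$ is a Lieb map if and only if $$\begin{pmatrix}\Phi(A)&\Phi(C)\\ \Phi(C)^*&\Phi(B)\end{pmatrix}\geq 0$$ for all $A,B,C\in\mathscr{A}$ such that $\begin{pmatrix}A&C\\ C^*&B\end{pmatrix}\geq 0$.
   Context: Maps between $C^*$-algebras are arbitrary functions; neither linearity nor continuity is assumed. $\mathscr{A}_+$ denotes the set of positive elements of $\mathscr{A}$. A map $\Phi:\mathscr{A}\to\mathscr{B}$ between $C^*$-algebras is called a Lieb map if it satisfies: (Monotonicity) $\Phi(A)\geq\Phi(B)$ whenever $A\geq B$ with $B\in\mathscr{A}_+$; (Cauchy--Schwarz) $\begin{bmatrix}\Phi(A^*A)&\Phi(A^*B)\\ \Phi(A^*B)^*&\Phi(B^*B)\end{bmatrix}\geq 0$ in $M_2(\mathscr{B})$ for every $A,B\in\mathscr{A}$. A von Neumann algebra is a unital $*$-subalgebra of $\mathbb{B}(\mathscr{H})$, for a complex Hilbert space $\mathscr{H}$, closed in the strong operator topology. *)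

(* Defs.v *)
From HB Require Import structures.
From mathcomp Require Import all_boot all_order all_algebra.
From mathcomp Require Import complex.
From mathcomp Require Import all_classical all_reals all_analysis.

Set Implicit Arguments.
Unset Strict Implicit.
Unset Printing Implicit Defensive.

Import Order.TTheory GRing.Theory Num.Theory.
Import numFieldNormedType.Exports.

Local Open Scope classical_set_scope.
Local Open Scope ring_scope.
Local Open Scope complex_scope.

(* Unital complex *-algebras.  [algType] would exclude the zero algebra (which
   is B(H) for H = 0), so the C-algebra structure on a ring is given by the
   central ring morphism z |-> z 1; the scalar multiple z x is [scal z * x]. *)
HB.mixin Record isStarAlgebra (C : numClosedFieldType) A & GRing.PzRing A := {
  scal : C -> A;
  scal1 : scal 1 = 1;
  scalD : forall z w : C, scal (z + w) = scal z + scal w;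
  scalM : forall z w : C, scal (z * w) = scal z * scal w;
  scalC : forall (z : C) (x : A), scal z * x = x * scal z;
  star : A -> A;
  starD : forall x y : A, star (x + y) = star x + star y;
  starM : forall x y : A, star (x * y) = star y * star x;
  star_scal : forall z : C, star (scal z) = scal (Num.conj z);
  starK : forall x : A, star (star x) = x
}.

#[short(type="starAlgType")]
HB.structure Definition StarAlgebra (C : numClosedFieldType) :=
  {A of GRing.PzRing A & isStarAlgebra C A}.

(* Hierarchy Builder accepts no join of normed modules and rings that is not an
   ordered domain, so the complete norm is spelled out. *)
HB.mixin Record isCStarAlgebra (R : realType) A & StarAlgebra R[i] A := {
  cnorm : A -> R;
  cnorm_eq0 : forall x : A, cnorm x = 0 -> x = 0;
  cnormD : forall x y : A, cnorm (x + y) <= cnorm x + cnorm y;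
  cnormZ : forall (z : R[i]) (x : A),
    (cnorm (scal z * x))%:C = `|z| * (cnorm x)%:C;
  cnormM : forall x y : A, cnorm (x * y) <= cnorm x * cnorm y;
  cnorm_star : forall x : A, cnorm (star x * x) = cnorm x ^+ 2;
  cnorm_complete : forall u : nat -> A,
    (forall e : R, 0 < e -> exists N : nat,
       forall m n, (N <= m)%N -> (N <= n)%N -> cnorm (u m - u n) < e) ->
    exists l : A, forall e : R, 0 < e -> exists N : nat,
       forall n, (N <= n)%N -> cnorm (u n - l) < e
}.

#[short(type="cstarAlgType")]
HB.structure Definition CStarAlgebra (R : realType) :=
  {A of StarAlgebra R[i] A & isCStarAlgebra R A}.

Section Positivity.
Variables (C : numClosedFieldType) (A : starAlgType C).
Implicit Types x y : A.

Definition invertible x := exists y, x * y = 1 /\ y * x = 1.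

Definition spectrum x : set C := [set z | ~ invertible (x - scal z)].

(* In a [numClosedFieldType], [0 <= z] means that z is real and nonnegative. *)
Definition positive x :=
  star x = x /\ forall z : C, spectrum x z -> 0 <= z.

Definition star_ge x y := positive (x - y).

End Positivity.

Section MatrixStarAlgebra.
Variables (C : numClosedFieldType) (A : starAlgType C) (n : nat).

Let mxscal (z : C) : 'M[A]_n := (scal z)%:M.
Let mxstar (M : 'M[A]_n) : 'M[A]_n := map_mx star M^T.

Let star0 : star (0 : A) = 0.
Proof. by apply: (addrI (star (0 : A))); rewrite -starD !addr0. Qed.

Let scal0 : scal 0 = 0 :> A.
Proof. by apply: (addrI (scal 0 : A)); rewrite -scalD !addr0. Qed.

Fact mxscal1 : mxscal 1 = 1.
Proof. by rewrite /mxscal scal1. Qed.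

Fact mxscalD z w : mxscal (z + w) = mxscal z + mxscal w.
Proof. by rewrite /mxscal scalD raddfD. Qed.

Fact mxscalM z w : mxscal (z * w) = mxscal z * mxscal w.
Proof. by rewrite /mxscal scalM scalar_mxM. Qed.

Fact mxscalC z M : mxscal z * M = M * mxscal z.
Proof.
apply/matrixP => i j; rewrite !mxE (bigD1 i) //= [RHS](bigD1 j) //= !mxE.
rewrite !eqxx !mulr1n !big1 ?addr0 ?scalC // => k kNi; rewrite !mxE.
  by rewrite (negPf kNi) mulr0.
by rewrite eq_sym (negPf kNi) mul0r.
Qed.

Fact mxstarD M N : mxstar (M + N) = mxstar M + mxstar N.
Proof. by apply/matrixP => i j; rewrite !mxE starD. Qed.

Fact mxstarM M N : mxstar (M * N) = mxstar N * mxstar M.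
Proof.
apply/matrixP => i j; rewrite !mxE (big_morph _ (@starD _ A) star0).
by apply: eq_bigr => k _; rewrite !mxE starM.
Qed.

Fact mxstar_scal z : mxstar (mxscal z) = mxscal (Num.conj z).
Proof.
apply/matrixP => i j; rewrite !mxE eq_sym.
by case: eqP => _; rewrite ?mulr1n ?mulr0n ?star0 ?star_scal.
Qed.

Fact mxstarK M : mxstar (mxstar M) = M.
Proof. by apply/matrixP => i j; rewrite !mxE starK. Qed.

HB.instance Definition _ := isStarAlgebra.Build C 'M[A]_n
  mxscal1 mxscalD mxscalM mxscalC mxstarD mxstarM mxstar_scal mxstarK.

End MatrixStarAlgebra.

Definition mx22 (T : Type) (a b c d : T) : 'M[T]_2 :=
  \matrix_(i < 2, j < 2)
    if i == 0 then (if j == 0 then a else b) else (if j == 0 then c else d).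

(* Only the *-algebra structure of a C*-algebra enters the definition. *)
Definition Lieb_map (C : numClosedFieldType) (A B : starAlgType C)
    (Phi : A -> B) :=
  (forall a b : A, positive b -> star_ge a b -> star_ge (Phi a) (Phi b)) /\
  (forall a b : A,
     positive (mx22 (Phi (star a * a))        (Phi (star a * b))
                    (star (Phi (star a * b))) (Phi (star b * b)))).

HB.mixin Record isHilbert (R : realType) H & CompleteNormedModule R[i] H := {
  inner : {dot H for (Num.conj : R[i] -> R[i])};
  inner_norm : forall x : H, inner x x = `|x| ^+ 2
}.

#[short(type="hilbertType")]
HB.structure Definition Hilbert (R : realType) :=
  {H of CompleteNormedModule R[i] H & isHilbert R H}.

Section BoundedOperators.
Variables (R : realType) (H : hilbertType R).

Definition bounded_operator (T : H -> H) : Prop :=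
  linear T /\ exists M : R[i], forall x, `|T x| <= M * `|x|.

Definition bounded_operators : {pred H -> H} :=
  fun T => `[< bounded_operator T >].

Record BH : Type := MkBH {
  BH_fun :> H -> H;
  _ : BH_fun \in bounded_operators
}.

HB.instance Definition _ := [isSub for BH_fun].
HB.instance Definition _ := [Choice of BH by <:].

Lemma BHP (T : BH) : bounded_operator (val T).
Proof. exact/asboolP/(valP T). Qed.

Let bound_ge0 (T : H -> H) : bounded_operator T ->
  exists2 M : R[i], 0 <= M & forall x, `|T x| <= M * `|x|.
Proof.
move=> [_ [M TM]]; case: (pselect (exists x : H, x != 0)) => [[x x0]|H0].
  exists M => //; have x_gt0 : 0 < `|x| by rewrite normr_gt0.
  by rewrite -(pmulr_lge0 _ x_gt0) (le_trans _ (TM x)).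
exists 0 => // x; have [x0|x0] := eqVneq x 0; last by case: H0; exists x.
by have := TM x; rewrite x0 normr0 !mulr0.
Qed.

Fact BH_submod_closed : submod_closed bounded_operators.
Proof.
split=> [|z S T /asboolP Sb /asboolP Tb]; apply/asboolP.
  split=> [a x y /=|]; first by rewrite scaler0 addr0.
  by exists 0 => x; rewrite mul0r normr0.
have [[Sl _] [Tl _]] := (Sb, Tb).
have [M M0 SM] := bound_ge0 Sb; have [N N0 TN] := bound_ge0 Tb.
split=> [a x y|].
  by rewrite !fctE Sl Tl !scalerDr !scalerA (mulrC z) addrACA.
exists (`|z| * M + N) => x.
rewrite (le_trans (ler_normD _ _)) // mulrDl lerD // normrZ -mulrA.
exact: ler_wpM2l.
Qed.

HB.instance Definition _ := GRing.SubChoice_isSubLmodule.Build _ _ _ BH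
  BH_submod_closed.

Fact BH_id_subproof : idfun \in bounded_operators.
Proof.
by apply/asboolP; split=> //; exists 1 => x; rewrite mul1r.
Qed.

Fact BH_comp_subproof (S T : BH) : val S \o val T \in bounded_operators.
Proof.
have [Sb Tb] := (BHP S, BHP T); apply/asboolP; split=> [a x y /=|].
  by rewrite Tb.1 Sb.1.
have [M M0 SM] := bound_ge0 Sb; have [N N0 TN] := bound_ge0 Tb.
exists (M * N) => x /=; rewrite (le_trans (SM _)) // -mulrA.
exact: ler_wpM2l.
Qed.

Definition BH_id : BH := Sub idfun BH_id_subproof.
Definition BH_comp (S T : BH) : BH := Sub (val S \o val T) (BH_comp_subproof S T).

Fact BH_compA : associative BH_comp.
Proof. by move=> S T U; apply/val_inj. Qed.

Fact BH_comp1T : left_id BH_id BH_comp.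
Proof. by move=> T; apply/val_inj. Qed.

Fact BH_compT1 : right_id BH_id BH_comp.
Proof. by move=> T; apply/val_inj. Qed.

Fact BH_compDl : left_distributive BH_comp +%R.
Proof. by move=> S T U; apply/val_inj. Qed.

Fact BH_compDr : right_distributive BH_comp +%R.
Proof.
move=> S T U; apply/val_inj/funext => x /=.
have := (BHP S).1 1 (val T x) (val U x).
by rewrite !scale1r.
Qed.

HB.instance Definition _ := GRing.Zmodule_isPzRing.Build BH
  BH_compA BH_comp1T BH_compT1 BH_compDl BH_compDr.

(* Every T in B(H) has exactly one adjoint, so [vn_adj] below says that T in
   the algebra implies T* in the algebra. *)
Definition is_adjoint (T T' : BH) :=
  forall x y : H, inner (val T x) y = inner x (val T' y).

(* B(H) with the strong operator topology, the one induced by pointwise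
   convergence on H *)
Definition sot : Type := initial_topology (fun T : BH => (T : {ptws H -> H})).

HB.instance Definition _ := Topological.on sot.

Record vonNeumannAlgebra := VonNeumannAlgebra {
  vn_set : set BH;
  vn_id : vn_set 1;
  vn_lin : forall (z : R[i]) S T, vn_set S -> vn_set T -> vn_set (z *: S + T);
  vn_mul : forall S T, vn_set S -> vn_set T -> vn_set (S * T);
  vn_adj : forall T, vn_set T -> exists2 T', vn_set T' & is_adjoint T T';
  vn_closed : closed (vn_set : set sot)
}.

End BoundedOperators.

Section VonNeumannStarAlgebra.
Variables (R : realType) (H : hilbertType R) (A : vonNeumannAlgebra H).

Definition vn_pred : {pred BH H} := fun T => T \in vn_set A.

Record vn_sort : Type := MkVN {
  vn_val :> BH H;
  _ : vn_val \in vn_pred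
}.

HB.instance Definition _ := [isSub for vn_val].
HB.instance Definition _ := [Choice of vn_sort by <:].

Fact vn_subring_closed : subring_closed vn_pred.
Proof.
split=> [|S T|S T]; rewrite !inE.
- exact: vn_id.
- by move=> AS AT; rewrite -scaleN1r addrC; apply: vn_lin.
- exact: vn_mul.
Qed.

HB.instance Definition _ := GRing.SubChoice_isSubPzRing.Build _ _ vn_sort
  vn_subring_closed.

Fact vn_scal_subproof (z : R[i]) : z *: (1 : BH H) \in vn_pred.
Proof.
rewrite inE -[_ *: _]addr0 -(subrr (1 : BH H)) -scaleN1r (addrC 1).
by do 2?[apply: vn_lin]; apply: vn_id.
Qed.

Definition vn_scal (z : R[i]) : vn_sort := MkVN (vn_scal_subproof z).

Fact vn_star_subproof (T : vn_sort) :
  {T' : vn_sort | is_adjoint (val T) (val T')}.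
Proof.
apply: cid; have := valP T; rewrite inE => /vn_adj[T' AT' TT'].
by exists (MkVN (mem_set AT')).
Qed.

Definition vn_star (T : vn_sort) : vn_sort := sval (vn_star_subproof T).

Lemma vn_starP (T : vn_sort) : is_adjoint (val T) (val (vn_star T)).
Proof. exact: (svalP (vn_star_subproof T)). Qed.

Let innerC (x y : H) : inner x y = Num.conj (inner y x).
Proof. by rewrite hermitian_subproof expr0 mul1r. Qed.

Let innerDl (x y w : H) : inner (x + y) w = inner x w + inner y w.
Proof. exact: linearDl. Qed.

Let innerDr (x y w : H) : inner w (x + y) = inner w x + inner w y.
Proof. by rewrite innerC (innerC w x) (innerC w y) innerDl rmorphD. Qed.

Let innerZl (z : R[i]) (x w : H) : inner (z *: x) w = z * inner x w.
Proof. exact: linearZl_LR. Qed.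

Let innerZr (z : R[i]) (x w : H) : inner w (z *: x) = Num.conj z * inner w x.
Proof. by rewrite innerC (innerC w x) innerZl rmorphM. Qed.

Let vn_starE (T S : vn_sort) : is_adjoint (val T) (val S) -> vn_star T = S.
Proof.
move=> TS; apply/val_inj/val_inj/funext => x; apply/eqP; rewrite -subr_eq0.
set d := _ - _; rewrite -normr_eq0 -sqrf_eq0 -inner_norm {2}/d -scaleN1r.
by rewrite innerDr innerZr -[X in X + _]vn_starP -TS rmorphN1 mulN1r subrr.
Qed.

Fact vn_scal1 : vn_scal 1 = 1.
Proof. by apply/val_inj; rewrite /= scale1r. Qed.

Fact vn_scalD z w : vn_scal (z + w) = vn_scal z + vn_scal w.
Proof. by apply/val_inj; rewrite /= scalerDl. Qed.

Fact vn_scalM z w : vn_scal (z * w) = vn_scal z * vn_scal w.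
Proof. by do 2!apply/val_inj; apply/funext => x /=; rewrite -scalerA. Qed.

Fact vn_scalC z T : vn_scal z * T = T * vn_scal z.
Proof.
do 2!apply/val_inj; apply/funext => x /=; have [Tl _] := BHP (val T).
have T0 : val (val T) 0 = 0.
  by apply: (addrI (val (val T) 0)); rewrite -{1}[val (val T) 0]scale1r -Tl
     scale1r !addr0.
by have := Tl z x 0; rewrite T0 !addr0.
Qed.

Fact vn_starD S T : vn_star (S + T) = vn_star S + vn_star T.
Proof. by apply: vn_starE => x y /=; rewrite innerDl innerDr !vn_starP. Qed.

Fact vn_starM S T : vn_star (S * T) = vn_star T * vn_star S.
Proof. by apply: vn_starE => x y /=; rewrite !vn_starP. Qed.

Fact vn_star_scal z : vn_star (vn_scal z) = vn_scal (Num.conj z).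
Proof. by apply: vn_starE => x y /=; rewrite innerZl innerZr conjCK. Qed.

Fact vn_starK T : vn_star (vn_star T) = T.
Proof. by apply: vn_starE => x y; rewrite innerC -vn_starP -innerC. Qed.

HB.instance Definition _ := isStarAlgebra.Build R[i] vn_sort
  vn_scal1 vn_scalD vn_scalM vn_scalC vn_starD vn_starM vn_star_scal vn_starK.

End VonNeumannStarAlgebra.

Coercion vn_sort : vonNeumannAlgebra >-> Sortclass.

(* Main.v *)
Require Import Defs.
From HB Require Import structures.
From Stdlib Require Ncring Ncring_tac.
From mathcomp Require Import all_boot all_order all_algebra.
From mathcomp Require Import complex.
From mathcomp Require Import all_classical all_reals all_analysis.
From mathcomp Require Import ring lra.

Set Implicit Arguments.
Unset Strict Implicit.
Unset Printing Implicit Defensive.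

Import Order.TTheory GRing.Theory Num.Theory.
Import numFieldNormedType.Exports.

Local Open Scope classical_set_scope.
Local Open Scope ring_scope.
Local Open Scope complex_scope.

(** Both directions rest on two facts, one about positivity in C*-algebras and
    one about von Neumann algebras.

    Matrices as forms. A matrix M over a C*-algebra is spectrally positive if
    and only if star v * M * v is positive for every column v
    ([mx_npos_positive]). Sums and congruences of positive matrices are then
    visibly positive, and so is the value of a positive matrix at a column.
    Spectral positivity is reached through order: a set of self-adjoint
    elements that is an archimedean cone, stable under congruence by commuting
    elements, and in which being bounded below by a positive scalar entails
    invertibility, is the set of spectrally positive elements
    ([cone_positive]). These properties pass from an algebra to its 2 x 2
    matrices, the invertibility through Schur complements
    ([spectral_cone_mx]). For a C*-algebra the cone consists of the
    self-adjoint h with ||M - h|| <= M for some M ([npos_cone]), and its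
    stability under all congruences is the theorem that star x * x is positive
    ([npos_star_sq]).

    Factorization. In a von Neumann algebra, if the matrix with rows (a, c) and
    (star c, b) is positive, then c = w y where w is the square root of a and
    star y * y <= b ([vn_factorization]); y is the strong limit of
    (a + s)^-1 w c as s decreases to 0.

    For a Lieb map Phi, the Cauchy-Schwarz property at (w, y) gives a positive
    matrix with entries Phi a, Phi c and Phi (star y * y), and monotonicity
    allows replacing the last entry by Phi b. Conversely, the Cauchy-Schwarz
    property is the image of the Gram matrix of (a, b), and for a >= b >= 0 the
    matrix with rows (a, b) and (b, b) is positive, so that the value of its
    image at the column (1, -1), which is Phi a - Phi b, is positive. *)

(** * Identities in noncommutative rings *)

Section NoncommutativeRing.
Variable E : pzRingType.

(** These two instances let [ncring] prove the polynomial identities that hold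
    in every ring. *)
Instance pzRing_ops :
  @Ncring.Ring_ops E 0 1 +%R *%R (fun x y => x - y) -%R eq := {}.

Instance pzRing_Ncring : @Ncring.Ring E _ _ _ _ _ _ _ pzRing_ops.
Proof.
split; try by (move=> ? ? -> ? ? ->) || (move=> ? ? ->).
- exact: RelationClasses.eq_equivalence.
- exact: add0r.
- exact: addrC.
- exact: addrA.
- exact: mul1r.
- exact: mulr1.
- exact: mulrA.
- exact: mulrDl.
- by move=> x y z; exact: mulrDr.
- by [].
- exact: addrN.
Qed.

End NoncommutativeRing.

#[local] Existing Instance pzRing_ops.
#[local] Existing Instance pzRing_Ncring.

Ltac ncring := Ncring_tac.non_commutative_ring.

(** * Real scalars and inverses in *-algebras *)

(** Order arguments involve real scalars only; in the algebra these are central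
    and self-adjoint. *)
Definition rscal (R : realType) (E : starAlgType R[i]) (t : R) : E := scal t%:C.
Notation "t %:S" := (rscal _ t) (at level 2, format "t %:S").

Section StarAlgebraTheory.
Variables (R : realType) (E : starAlgType R[i]).
Implicit Types (x y : E) (s t : R).

Lemma star0 : star (0 : E) = 0.
Proof. by apply: (addrI (star (0 : E))); rewrite -starD !addr0. Qed.

Lemma starN x : star (- x) = - star x.
Proof. by apply: (addrI (star x)); rewrite -starD !subrr star0. Qed.

Lemma starB x y : star (x - y) = star x - star y.
Proof. by rewrite starD starN. Qed.

Lemma star1 : star (1 : E) = 1.
Proof. by rewrite -(scal1 (s := E)) star_scal rmorph1. Qed.

Lemma rscal0 : 0%:S = 0 :> E.
Proof. by apply: (addrI (0%:S)); rewrite -scalD !addr0. Qed.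

Lemma rscal1 : 1%:S = 1 :> E.
Proof. exact: scal1. Qed.

Lemma rscalD s t : (s + t)%:S = s%:S + t%:S :> E.
Proof. by rewrite /rscal rmorphD scalD. Qed.

Lemma rscal2 : 2%:S = 1 + 1 :> E.
Proof. by rewrite (_ : 2 = 1 + 1 :> R) // rscalD rscal1. Qed.

Lemma rscalM s t : (s * t)%:S = s%:S * t%:S :> E.
Proof. by rewrite /rscal rmorphM scalM. Qed.

Lemma rscalN t : (- t)%:S = - t%:S :> E.
Proof. by apply: (addrI (t%:S)); rewrite -rscalD !subrr rscal0. Qed.

Lemma rscalB s t : (s - t)%:S = s%:S - t%:S :> E.
Proof. by rewrite rscalD rscalN. Qed.

Lemma rscalC t x : t%:S * x = x * t%:S.
Proof. exact: scalC. Qed.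

Lemma rscalCA t x y : x * (t%:S * y) = t%:S * (x * y).
Proof. by rewrite mulrA -rscalC mulrA. Qed.

Lemma rscalK t x : t != 0 -> t%:S * (t^-1%:S * x) = x.
Proof. by move=> t0; rewrite mulrA -rscalM divff // rscal1 mul1r. Qed.

Lemma star_rscal t : star (t%:S : E) = t%:S.
Proof. by rewrite star_scal; congr scal; exact: conjc_real. Qed.

Lemma star_inv x y : star x = x -> x * y = 1 -> y * x = 1 -> star y = y.
Proof.
move=> xs xy yx; have: star (x * y) * y = y by rewrite xy star1 mul1r.
by rewrite starM xs -mulrA xy mulr1.
Qed.

Lemma invertible_comm x y : x * y = y * x -> invertible (x * y) -> invertible x.
Proof.
move=> xyC [z [xyz zxy]]; exists (y * z); split; first by rewrite mulrA.
have zx : z * x = x * z.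
  have xxy : x * (x * y) = x * y * x by rewrite -mulrA xyC.
  by rewrite -[LHS]mulr1 -xyz mulrA -(mulrA z) xxy !mulrA -(mulrA z) zxy mul1r.
by rewrite -mulrA zx mulrA -xyC xyz.
Qed.

Lemma invertibleM x y : invertible x -> invertible y -> invertible (x * y).
Proof.
move=> [x' [xx' x'x]] [y' [yy' y'y]]; exists (y' * x').
split; first by rewrite -mulrA (mulrA y) yy' mul1r.
by rewrite -mulrA (mulrA x') x'x mul1r.
Qed.

Lemma comm_inv x y y' : y * y' = 1 -> y' * y = 1 -> x * y = y * x ->
  x * y' = y' * x.
Proof.
by move=> yy' y'y xy; rewrite -[LHS]mul1r -y'y -!mulrA (mulrA y) -xy -mulrA
  yy' mulr1.
Qed.

End StarAlgebraTheory.

(** * Cones that describe spectral positivity *)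

(** The order properties that determine the spectrally positive elements.
    Congruence is restricted to self-adjoint elements commuting with x, which in
    a C*-algebra can be established before the positivity of star x * x. *)
Record spectral_cone (R : realType) (E : starAlgType R[i]) (P : E -> Prop) := {
  cone_sa : forall x, P x -> star x = x;
  cone1 : P 1;
  coneD : forall x y, P x -> P y -> P (x + y);
  coneZ : forall (t : R) x, 0 <= t -> P x -> P (t%:S * x);
  coneJ : forall x y, star y = y -> x * y = y * x -> P x -> P (y * x * y);
  cone_bound : forall x, star x = x -> exists2 K : R, 0 < K & P (K%:S - x);
  cone_closed : forall x, (forall t : R, 0 < t -> P (x + t%:S)) -> P x;
  cone_inv : forall (t : R) x, 0 < t -> P (x - t%:S) -> invertible x }.

Section SpectralCone.
Variables (R : realType) (E : starAlgType R[i]) (P : E -> Prop).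
Hypothesis PE : spectral_cone P.
Implicit Types (x y : E) (s t : R).

Lemma cone_rscal t : 0 <= t -> P t%:S.
Proof.
by move=> t0; rewrite -[t%:S]mulr1; apply: (coneZ PE) => //; exact: cone1 PE.
Qed.

Lemma cone_sq x : star x = x -> P (x * x).
Proof.
move=> xs; rewrite -[X in X * _]mulr1; apply: (coneJ PE) => //.
  by rewrite mulr1 mul1r.
exact: cone1 PE.
Qed.

(** If x <= K and the inverse y of x satisfies y^2 <= L, then
    K x >= x^2 >= 1 / L. The first inequality holds since K (K x - x^2) is the
    sum of x (K - x) x and (K - x) x (K - x), the second is the congruence of
    L - y^2 by x. *)
Lemma cone_gap x : P x -> invertible x -> exists2 e : R, 0 < e & P (x - e%:S).
Proof.
move=> Px [y [xy yx]]; have xs := cone_sa PE Px; have ys := star_inv xs xy yx.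
have [K K0 PK] := cone_bound PE xs.
have [L L0 PL] : exists2 L : R, 0 < L & P (L%:S - y * y).
  by apply: (cone_bound PE); rewrite starM ys.
have P1 : P (L%:S * (x * x) - 1).
  rewrite [X in P X](_ : _ = x * (L%:S - y * y) * x); last first.
    by rewrite mulrBr mulrBl -rscalC -!mulrA yx mulr1 xy.
  apply: (coneJ PE) => //.
  by rewrite mulrBl mulrBr rscalC -mulrA yx mulrA xy mulr1 mul1r.
have P2 : P (K%:S * x - x * x).
  rewrite -[X in P X](@rscalK _ _ K^-1) ?invr_eq0 ?gt_eqF // invrK.
  apply: (coneZ PE); first by rewrite invr_ge0 ltW.
  rewrite [X in P X](_ : _ = x * (K%:S - x) * x + (K%:S - x) * x * (K%:S - x)).
    apply: (coneD PE); apply: (coneJ PE) => //.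
    - by rewrite mulrBl mulrBr rscalC.
    - by rewrite starB star_rscal xs.
    - by rewrite mulrBl mulrBr rscalC.
  rewrite [(_ - x) * x]mulrBl [K%:S * x]rscalC -mulrBr -!mulrA -mulrDr -mulrDr.
  by rewrite subrKC -rscalC rscalCA.
have LK0 : 0 < L * K by rewrite mulr_gt0.
exists (L * K)^-1; first by rewrite invr_gt0.
rewrite -[X in P X](@rscalK _ _ (L * K)^-1) ?invr_eq0 ?gt_eqF // invrK.
apply: (coneZ PE); first by rewrite invr_ge0 ltW.
rewrite mulrBr -rscalM divff ?gt_eqF // rscal1.
rewrite [X in P X](_ : _ = L%:S * (K%:S * x - x * x) + (L%:S * (x * x) - 1)).
  by apply: (coneD PE) => //; apply: (coneZ PE) => //; exact: ltW.
rewrite rscalM; ncring.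
Qed.

(** Let t be the infimum of the scalars for which x + t lies in the cone. By
    closedness x + t lies in it, and if t were positive, x + t would be
    invertible and [cone_gap] would produce a smaller scalar. *)
Lemma cone_of_invertible x : star x = x ->
  (forall t : R, 0 < t -> invertible (x + t%:S)) -> P x.
Proof.
move=> xs x_inv.
pose S := [set t : R | 0 <= t /\ P (x + t%:S)].
have [K K0 PK] : exists2 K : R, 0 < K & P (K%:S - - x).
  by apply: (cone_bound PE); rewrite starN xs.
have S0 : S !=set0 by exists K; split; rewrite ?ltW // addrC -[x]opprK.
have infS : has_inf S by split => //; exists 0 => t [].
have t0 : 0 <= inf S by apply: lb_le_inf => // t [].
have Pt : P (x + (inf S)%:S).
  apply: (cone_closed PE) => e e0.
  have [s [s0 Ps] sle] := inf_adherent e0 infS.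
  rewrite -addrA -rscalD [_ + e](_ : _ = s + (inf S + e - s)); last by ring.
  rewrite rscalD addrA; apply: (coneD PE) => //; apply: cone_rscal.
  by rewrite subr_ge0 ltW.
have [t00|t_neq0] := eqVneq (inf S) 0.
  by move: Pt; rewrite t00 rscal0 addr0.
have {t_neq0}t_gt0 : 0 < inf S by rewrite lt_neqAle eq_sym t_neq0.
have [e e0 Pe] := cone_gap Pt (x_inv _ t_gt0).
pose d := Num.min e (inf S).
have d0 : 0 < d by rewrite lt_min e0.
suff Sd : S (inf S - d).
  have : inf S <= inf S - d by exact: ge_inf (proj2 infS) _ Sd.
  by rewrite lerDl oppr_ge0 leNgt d0.
split; first by rewrite subr_ge0 ge_min lexx orbT.
rewrite rscalB addrA -[d](subrKC e) rscalD opprD addrA; apply: (coneD PE) => //.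
by rewrite -rscalN; apply: cone_rscal; rewrite opprB subr_ge0 ge_min lexx.
Qed.

(** An element x of the cone is self-adjoint, so (x - a)^2 + b^2 is bounded
    below by b^2, which excludes the spectral values a + i b off the real axis;
    the negative ones are excluded because x + t is bounded below by t. *)
Lemma cone_positive x : P x <-> positive x.
Proof.
split=> [Px|[xs x_ge0]]; last first.
  apply: cone_of_invertible => // t t0; apply: contrapT => nx.
  suff : (0 : R[i]) <= (- t)%:C by rewrite ler0c oppr_ge0 leNgt t0.
  by apply: x_ge0; rewrite /spectrum /= -/(rscal _ _) rscalN opprK.
have xs := cone_sa PE Px; split=> // -[a b] nsp.
apply: contrapT => z_ge0; apply: nsp.
have [b0|b0] := eqVneq b 0.
  have a0 : a < 0.
    by rewrite ltNge; apply/negP => a0; apply: z_ge0; rewrite lecE /= b0 eqxx.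
  apply: (cone_inv PE (t := - a)); first by rewrite oppr_gt0.
  by rewrite b0 complexr0 rscalN opprK subrK.
(* with e = i b and w the conjugate of z, (x - z)(x - w) = (x - a)^2 + b^2 *)
set e : E := scal (0 +i* b).
have eC y : e * y = y * e by exact: scalC.
have ee : e * e = - (b ^+ 2)%:S.
  by rewrite -scalM -rscalN; congr scal; simpc; rewrite expr2.
have zE : scal (a +i* b) = a%:S + e by rewrite -scalD; congr scal; simpc.
have z'E : scal (a -i* b) = a%:S - e.
  apply: (addIr e); rewrite subrK -scalD; congr scal; apply/eqP.
  by rewrite eq_complex /= addr0 addNr !eqxx.
apply: (@invertible_comm _ _ _ (x - scal (a -i* b))).
  rewrite zE z'E !opprD !addrA; move: (x - _) => d.
  by rewrite opprK !mulrDl !mulrDr !mulNr !mulrN -(eC d); ncring.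
apply: (cone_inv PE (t := b ^+ 2)); first by rewrite exprn_even_gt0.
rewrite [X in P X](_ : _ = (x - a%:S) * (x - a%:S)).
  by apply: cone_sq; rewrite starB star_rscal xs.
rewrite zE z'E !opprD !addrA; move: (x - _) => d.
by rewrite opprK !mulrDl !mulrDr !mulNr -(eC d) ee; ncring.
Qed.

End SpectralCone.

(** * Two by two matrices *)

Section Matrix22.
Variables (R : realType) (E : starAlgType R[i]).
Implicit Types (M N : 'M[E]_2) (a b c d x y : E).

Lemma mx22_ext M N : M 0 0 = N 0 0 -> M 0 1 = N 0 1 -> M 1 0 = N 1 0 ->
  M 1 1 = N 1 1 -> M = N.
Proof.
move=> e00 e01 e10 e11; apply/matrixP => i j.
have I2 (k : 'I_2) : k = 0 \/ k = 1.
  by case: k => [[|[|//]]] lt_k; [left|right]; apply/val_inj.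
by case: (I2 i) => ->; case: (I2 j) => ->.
Qed.

Lemma mx22_00 a b c d : mx22 a b c d 0 0 = a. Proof. by rewrite mxE. Qed.
Lemma mx22_01 a b c d : mx22 a b c d 0 1 = b. Proof. by rewrite mxE. Qed.
Lemma mx22_10 a b c d : mx22 a b c d 1 0 = c. Proof. by rewrite mxE. Qed.
Lemma mx22_11 a b c d : mx22 a b c d 1 1 = d. Proof. by rewrite mxE. Qed.
Definition mx22E := (mx22_00, mx22_01, mx22_10, mx22_11).

Lemma mx22_eta M : M = mx22 (M 0 0) (M 0 1) (M 1 0) (M 1 1).
Proof. by apply: mx22_ext; rewrite mx22E. Qed.

Lemma add_mx22 a b c d a' b' c' d' :
  mx22 a b c d + mx22 a' b' c' d' = mx22 (a + a') (b + b') (c + c') (d + d').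
Proof. by apply: mx22_ext; rewrite !mxE. Qed.

Lemma sub_mx22 a b c d a' b' c' d' :
  mx22 a b c d - mx22 a' b' c' d' = mx22 (a - a') (b - b') (c - c') (d - d').
Proof. by apply: mx22_ext; rewrite !mxE. Qed.

Lemma mul_mx22 a b c d a' b' c' d' : mx22 a b c d * mx22 a' b' c' d' =
  mx22 (a * a' + b * c') (a * b' + b * d') (c * a' + d * c') (c * b' + d * d').
Proof.
by apply: mx22_ext; rewrite !mxE !big_ord_recl big_ord0 addr0 !mxE.
Qed.

Lemma one_mx22 : 1 = mx22 1 0 0 1 :> 'M[E]_2.
Proof. by apply: mx22_ext; rewrite !mxE. Qed.

Lemma rscal_mx22 (t : R) : t%:S = mx22 t%:S 0 0 t%:S :> 'M[E]_2.
Proof. by apply: mx22_ext; rewrite !mxE. Qed.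

Lemma star_mx22 a b c d :
  star (mx22 a b c d) = mx22 (star a) (star c) (star b) (star d).
Proof. by apply: mx22_ext; rewrite !mxE. Qed.

Lemma mx22_inj a b c d a' b' c' d' : mx22 a b c d = mx22 a' b' c' d' ->
  [/\ a = a', b = b', c = c' & d = d'].
Proof.
move=> /matrixP e; move: (e 0 0) (e 0 1) (e 1 0) (e 1 1).
by rewrite !mx22E.
Qed.

(** The value star v * M * v at the column v with entries x and y. *)
Definition qform M x y :=
  star x * (M 0 0 * x + M 0 1 * y) + star y * (M 1 0 * x + M 1 1 * y).

Lemma qform_mx22 a b c d x y : qform (mx22 a b c d) x y =
  star x * (a * x + b * y) + star y * (c * x + d * y).
Proof. by rewrite /qform !mx22E. Qed.

Lemma qformD M N x y : qform (M + N) x y = qform M x y + qform N x y.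
Proof. rewrite /qform !mxE; ncring. Qed.

Lemma qform_congr M N x y :
  qform (star N * M * N) x y =
  qform M (N 0 0 * x + N 0 1 * y) (N 1 0 * x + N 1 1 * y).
Proof.
rewrite (mx22_eta M) (mx22_eta N) star_mx22 !mul_mx22 !qform_mx22 !mx22E.
rewrite !starD !starM; ncring.
Qed.

Lemma qform_rscal (t : R) x y :
  qform t%:S x y = t%:S * (star x * x + star y * y).
Proof.
by rewrite rscal_mx22 qform_mx22 !mul0r addr0 add0r !rscalCA mulrDr.
Qed.

End Matrix22.

Section MatrixCone.
Variables (R : realType) (E : starAlgType R[i]) (P : E -> Prop).
Hypothesis PE : spectral_cone P.
Hypothesis PJ : forall x y, P x -> P (star y * x * y).

(** Evaluating at columns reduces positivity of matrices to positivity in E. *)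
Definition mx_cone (M : 'M[E]_2) := star M = M /\ forall x y, P (qform M x y).

Lemma cone_star_sq x : P (star x * x).
Proof. by rewrite -[star x]mulr1; apply: PJ; exact: cone1 PE. Qed.

Lemma qform1 x y : P (star x * x + star y * y).
Proof. by apply: (coneD PE); exact: cone_star_sq. Qed.

Lemma mx_coneJ M N : mx_cone M -> mx_cone (star N * M * N).
Proof.
move=> [Ms PM]; split; first by rewrite !starM starK Ms mulrA.
by move=> x y; rewrite qform_congr.
Qed.

Lemma mx_cone_bound (M : 'M[E]_2) : star M = M ->
  exists2 K : R, 0 < K & mx_cone (K%:S - M).
Proof.
move=> Ms; move: (Ms); rewrite (mx22_eta M) star_mx22 => /mx22_inj.
move: (M 0 0) (M 0 1) (M 1 0) (M 1 1) => a b c d [as_ cb bc ds].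
have [k k0 Pk] := cone_bound PE as_.
have [l l0 Pl] := cone_bound PE ds.
have [m m0 Pm] : exists2 m : R, 0 < m & P (m%:S - b * star b).
  by apply: (cone_bound PE); rewrite starM starK.
exists (k + l + m + 1); first by rewrite !addr_gt0.
split=> [|x y]; first by rewrite starB star_rscal star_mx22 as_ ds bc cb.
rewrite rscal_mx22 sub_mx22 qform_mx22 !sub0r.
(* the off-diagonal part is absorbed by the square of (star b) x - y *)
rewrite [X in P X](_ : _ = star x * (k%:S - a) * x + star y * (l%:S - d) * y +
  star x * (m%:S - b * star b) * x +
  star (star b * x - y) * (star b * x - y) + (l + 1)%:S * (star x * x) +
  (k + m)%:S * (star y * y)); last first.
  rewrite bc starB !starM cb !rscalD rscal1 !mulrDl -!rscalCA mul1r.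
  ncring.
do !apply: (coneD PE); try exact: PJ; first exact: cone_star_sq.
- by apply: (coneZ PE); rewrite ?addr_ge0 ?ltW //; exact: cone_star_sq.
- by apply: (coneZ PE); rewrite ?addr_ge0 ?ltW //; exact: cone_star_sq.
Qed.

(** The corner a is bounded below by t, hence invertible. Its Schur complement
    is the value of M at the column (- a^-1 b, 1), hence also bounded below by t
    and invertible. M is the product of a lower unitriangular, a block diagonal
    and an upper unitriangular matrix. *)
Lemma mx_cone_inv (t : R) (M : 'M[E]_2) : 0 < t -> mx_cone (M - t%:S) ->
  invertible M.
Proof.
move=> t0 [Ms PM].
have {}Ms : star M = M by move: Ms; rewrite starB star_rscal => /addIr.
move: (Ms) PM; rewrite (mx22_eta M) star_mx22 => /mx22_inj.
move: (M 0 0) (M 0 1) (M 1 0) (M 1 1) => a b c d [as_ cb bc ds].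
rewrite rscal_mx22 sub_mx22 !subr0 => PM.
have /(cone_inv PE t0) [a' [aa' a'a]] : P (a - t%:S).
  have := PM 1 0; rewrite qform_mx22 star1 star0.
  by rewrite !mulr0 !mul0r !addr0 mulr1 mul1r.
have a's : star a' = a' by apply: star_inv aa' a'a.
have /(cone_inv PE t0) [s [us su]] : P (d - c * a' * b - t%:S).
  rewrite [X in P X](_ : _ =
      qform (mx22 (a - t%:S) b c (d - t%:S)) (- (a' * b)) 1 +
      t%:S * (star (a' * b) * (a' * b))).
    apply: (coneD PE) => //; apply: (coneZ PE); rewrite ?ltW //.
    exact: cone_star_sq.
  rewrite qform_mx22 star1 starN starM a's bc.
  have aab : a * (a' * b) = b by rewrite mulrA aa' mul1r.
  rewrite mulrN [(a - _) * _]mulrBl aab -(rscalCA t (c * a')); ncring.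
have : mx22 a b c d = mx22 1 0 (c * a') 1 * (mx22 a 0 0 (d - c * a' * b)) *
         mx22 1 (a' * b) 0 1.
  rewrite !mul_mx22 !(mulr0, mul0r, mulr1, mul1r, addr0, add0r) -!mulrA a'a.
  by rewrite (mulrA a) aa' mul1r mulr1 subrKC.
move=> ->; apply: invertibleM; [apply: invertibleM|].
- exists (mx22 1 0 (- (c * a')) 1); rewrite !mul_mx22 one_mx22.
  by rewrite !(mulr0, mul0r, mulr1, mul1r, addr0, add0r) subrr addNr.
- exists (mx22 a' 0 0 s); rewrite !mul_mx22 one_mx22.
  by rewrite !(mulr0, mul0r, mulr1, mul1r, addr0, add0r) aa' a'a us su.
- exists (mx22 1 (- (a' * b)) 0 1); rewrite !mul_mx22 one_mx22.
  by rewrite !(mulr0, mul0r, mulr1, mul1r, addr0, add0r) subrr addNr.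
Qed.

Lemma spectral_cone_mx : spectral_cone mx_cone.
Proof.
split.
- by move=> M [].
- split=> [|x y]; first exact: star1.
  by rewrite -rscal1 qform_rscal rscal1 mul1r; exact: qform1.
- move=> M N [Ms PM] [Ns PN]; split=> [|x y]; first by rewrite starD Ms Ns.
  by rewrite qformD; apply: (coneD PE).
- move=> t M t0 [Ms PM]; split=> [|x y].
    by rewrite starM Ms star_rscal -rscalC.
  suff -> : qform (t%:S * M) x y = t%:S * qform M x y by apply: (coneZ PE).
  rewrite (mx22_eta M) rscal_mx22 mul_mx22 !qform_mx22 !mul0r !add0r !addr0.
  by rewrite -!mulrA -!mulrDr !rscalCA -mulrDr.
- by move=> M N Ns _ PM; rewrite -{1}Ns; exact: mx_coneJ.
- exact: mx_cone_bound.
- move=> M PM.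
  have Ms : star M = M.
    by have [] := PM 1 ltr01; rewrite starD star_rscal => /addIr.
  split=> // x y.
  have [K K0 PK] : exists2 K : R, 0 < K & P (K%:S - (star x * x + star y * y)).
    by apply: (cone_bound PE); rewrite starD !starM !starK.
  apply: (cone_closed PE) => t t0.
  have tK : 0 < t / K by rewrite divr_gt0.
  rewrite [X in P X](_ : _ = qform (M + (t / K)%:S) x y +
    (t / K)%:S * (K%:S - (star x * x + star y * y))).
    apply: (coneD PE); first by have [] := PM _ tK.
    by apply: (coneZ PE) => //; exact: ltW.
  rewrite qformD qform_rscal mulrBr -rscalM divfK ?gt_eqF //; ncring.
- exact: mx_cone_inv.
Qed.

End MatrixCone.

(** * Norm limits and square roots in C*-algebras *)

Lemma nondecreasing_bounded_cauchy (R : realType) (c : nat -> R) (K : R) :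
  (forall n, c n <= c n.+1) -> (forall n, c n <= K) ->
  forall e, 0 < e -> exists N, forall m n, (N <= n)%N -> (n <= m)%N ->
    0 <= c m - c n < e.
Proof.
move=> c_incr cK e e0.
have c_mono : {homo c : m n / (m <= n)%N >-> m <= n}.
  exact: (homo_leq (@lexx _ _) (@le_trans _ _)).
have supc : has_sup (range c).
  by split; [exists (c 0%N), 0%N | exists K => _ [n _ <-]].
have [_ [N _ <-] cN] := sup_adherent e0 supc.
exists N => m n Nn nm; rewrite subr_ge0 c_mono //= ltrBlDr.
have cm : c m <= sup (range c) by apply: ub_le_sup; [exact: supc.2 | exists m].
rewrite (le_lt_trans cm) // -ltrBlDl (lt_le_trans cN) //; exact: c_mono.
Qed.

Lemma recursive_seq (T : Type) (x : T) (f : T -> T) :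
  exists u : nat -> T, u 0%N = x /\ forall n, u n.+1 = f (u n).
Proof. by exists (fun n => iter n f x). Qed.

Section CStarNorm.
Variables (R : realType) (B : cstarAlgType R).
Implicit Types (x y h k l : B) (t : R) (u v : nat -> B).

Lemma cnorm_rscal t x : cnorm (t%:S * x) = `|t| * cnorm x.
Proof.
apply: (@complexI R); rewrite cnormZ rmorphM /=; congr (_ * _).
by rewrite normc_def /= expr0n addr0 sqrtr_sqr.
Qed.

Lemma cnorm0 : cnorm (0 : B) = 0.
Proof. by rewrite -(mul0r (0 : B)) -rscal0 cnorm_rscal normr0 mul0r. Qed.

Lemma cnormN x : cnorm (- x) = cnorm x.
Proof. by rewrite -mulN1r -rscal1 -rscalN cnorm_rscal normrN1 mul1r. Qed.

Lemma cnormBC x y : cnorm (x - y) = cnorm (y - x).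
Proof. by rewrite -cnormN opprB. Qed.

Lemma cnormB x y : cnorm (x - y) <= cnorm x + cnorm y.
Proof. by rewrite -(cnormN y) cnormD. Qed.

Lemma cnorm_ge0 x : 0 <= cnorm x.
Proof.
rewrite -(pmulr_rge0 _ (ltr0n _ 2)) mulr_natl mulr2n.
by rewrite -[0]cnorm0 -(subrr x) cnormB.
Qed.

Lemma cnorm_star_eq x : cnorm (star x) = cnorm x.
Proof.
have H y : cnorm y <= cnorm (star y).
  have [->|y0] := eqVneq (cnorm y) 0; first exact: cnorm_ge0.
  have y_gt0 : 0 < cnorm y by rewrite lt_neqAle eq_sym y0 cnorm_ge0.
  by rewrite -(ler_pM2r y_gt0) -expr2 -cnorm_star cnormM.
by apply/le_anti; rewrite H -{2}[x]starK H.
Qed.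

Lemma cnorm_sa_sq x : star x = x -> cnorm (x * x) = cnorm x ^+ 2.
Proof. by move=> xs; rewrite -{1}xs cnorm_star. Qed.

Lemma cnorm1_le1 : cnorm (1 : B) <= 1.
Proof.
have /eqP := cnorm_sa_sq (star1 B); rewrite mulr1 expr2 -subr_eq0.
rewrite -{1}[cnorm 1]mulr1 -mulrBr mulf_eq0 subr_eq0 => /orP[]/eqP.
  by move=> ->.
by move=> <-.
Qed.

Lemma cnorm_rscal1 t : cnorm (t%:S : B) <= `|t|.
Proof.
by rewrite -[t%:S]mulr1 cnorm_rscal ler_piMr ?normr_ge0 ?cnorm1_le1.
Qed.

Lemma sa_cube_eq0 x : star x = x -> x * x * x = 0 -> x = 0.
Proof.
move=> xs x3; apply/cnorm_eq0/eqP; rewrite -sqrf_eq0 -cnorm_sa_sq //.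
rewrite -sqrf_eq0 -cnorm_sa_sq ?starM ?xs // mulrA x3 mul0r cnorm0 //.
Qed.

Definition clim u x := (fun n => cnorm (u n - x)) @ \oo --> (0 : R).

Lemma clim_le u x (e : nat -> R) : e @ \oo --> (0 : R) ->
  (forall n, cnorm (u n - x) <= e n) -> clim u x.
Proof.
move=> e0 ue; apply: (squeeze_cvgr _ (cvg_cst 0) e0).
by apply: nearW => n; rewrite cnorm_ge0 ue.
Qed.

Lemma cvg_le_const (e : nat -> R) (c : R) : e @ \oo --> (0 : R) ->
  (forall n, c <= e n) -> c <= 0.
Proof.
move=> e0 ce; apply: (ler_cvg_to (cvg_cst c) e0); exact: nearW.
Qed.

Lemma clim_unique u x y : clim u x -> clim u y -> x = y.
Proof.
move=> ux uy; apply/eqP; rewrite -subr_eq0; apply/eqP/cnorm_eq0/le_anti.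
rewrite cnorm_ge0 andbT.
have s : (fun n => cnorm (u n - x) + cnorm (u n - y)) @ \oo --> (0 : R).
  by rewrite -[X in _ --> X]addr0; exact: cvgD.
apply: (cvg_le_const s) => n /=.
by rewrite -[x - y](subrKA (u n)) (cnormBC _ x) cnormD.
Qed.

Lemma clim_star u x : clim u x -> clim (star \o u) (star x).
Proof.
by rewrite /clim => ux; under eq_fun do rewrite /= -starB cnorm_star_eq.
Qed.

Lemma clim_cst x : clim (fun=> x) x.
Proof.
by apply: (clim_le (cvg_cst 0)) => n; rewrite subrr cnorm0.
Qed.

Lemma climD u v x y : clim u x -> clim v y -> clim (u \+ v) (x + y).
Proof.
move=> ux vy.
have s : (fun n => cnorm (u n - x) + cnorm (v n - y)) @ \oo --> (0 : R).
  by rewrite -[X in _ --> X]addr0; exact: cvgD.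
by apply: (clim_le s) => n; rewrite /= opprD addrACA cnormD.
Qed.

Lemma climM u v x y : clim u x -> clim v y -> clim (u \* v) (x * y).
Proof.
move=> ux vy.
have s : (fun n => cnorm (u n - x) * cnorm (v n - y) + cnorm (u n - x) * cnorm y
    + cnorm (v n - y) * cnorm x) @ \oo --> (0 : R).
  have -> : 0 = 0 * 0 + 0 * cnorm y + 0 * cnorm x by rewrite !mul0r !addr0.
  apply: cvgD; last exact: cvgMr_tmp.
  by apply: cvgD; [exact: cvgM|exact: cvgMr_tmp].
apply: (clim_le s) => n /=.
have -> : u n * v n - x * y =
    (u n - x) * (v n - y) + (u n - x) * y + x * (v n - y).
  ncring.
apply: (le_trans (cnormD _ _)); rewrite lerD // ?(mulrC _ (cnorm x)) ?cnormM //.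
by apply: (le_trans (cnormD _ _)); rewrite lerD ?cnormM.
Qed.

Lemma clim_shift u x : clim u x -> clim (fun n => u n.+1) x.
Proof.
move=> ux; have := cvg_shiftS (fun n => cnorm (u n - x)) (nbhs (0 : R)).
by rewrite /clim => ->.
Qed.

Lemma clim_comm u x y : clim u x -> (forall n, y * u n = u n * y) ->
  y * x = x * y.
Proof.
move=> ux yu; apply: (clim_unique (climM (clim_cst y) ux)).
rewrite (_ : _ \* _ = u \* (fun=> y)); last by apply/funext => n /=.
by apply: climM => //; exact: clim_cst.
Qed.

Lemma clim_norm_le u x t : clim u x -> (forall n, cnorm (u n) <= t) ->
  cnorm x <= t.
Proof.
move=> ux ut; rewrite -subr_le0; apply: (cvg_le_const ux) => n.
rewrite lerBlDr (le_trans _ (lerD (lexx _) (ut n))) //.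
by rewrite cnormBC -{1}(subrK (u n) x) cnormD.
Qed.

(** The real sequence c stands for the partial sums of a convergent series that
    dominates the steps of u. *)
Lemma clim_majorant u (c : nat -> R) K :
  (forall n, cnorm (u n.+1 - u n) <= c n.+1 - c n) -> (forall n, c n <= K) ->
  exists x, clim u x.
Proof.
move=> uc cK.
have c_incr n : c n <= c n.+1.
  by rewrite -subr_ge0 (le_trans _ (uc n)) ?cnorm_ge0.
have uc' n d : cnorm (u (n + d)%N - u n) <= c (n + d)%N - c n.
  elim: d => [|d IH]; first by rewrite addn0 !subrr cnorm0.
  rewrite addnS -[_ - u n](subrKA (u (n + d)%N)).
  rewrite -[_ - c n](subrKA (c (n + d)%N)).
  by rewrite (le_trans (cnormD _ _)) // lerD.
have [|x xP] := @cnorm_complete _ B u.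
  move=> e e0; have [N NP] := nondecreasing_bounded_cauchy c_incr cK e0.
  exists N => m n; wlog nm : m n / (n <= m)%N.
    move=> W Nm Nn.
    by case/orP: (leq_total n m) => /W; [|rewrite cnormBC]; apply.
  move=> _ Nn; have /andP[_] := NP m n Nn nm; apply: le_lt_trans.
  by rewrite -(subnKC nm).
exists x; apply/cvgrPdist_lt => e /xP [N NP]; near=> n.
rewrite sub0r normrN ger0_norm ?cnorm_ge0 //; apply: NP.
by near: n; exists N.
Unshelve. all: by end_near. Qed.

(** The partial sums of the geometric series are the iterates of y |-> 1 + x y
    from 0; the same recursion on the norm of x is a majorant. *)
Lemma neumann x : cnorm x < 1 -> invertible (1 - x).
Proof.
move=> x1; pose q := cnorm x; have q0 : 0 <= q := cnorm_ge0 x.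
have [u [u0 uS]] := recursive_seq 0 (fun y => 1 + x * y).
have [c [c0 cS]] := recursive_seq 0 (fun r => 1 + q * r).
have xu n : x * u n = u n * x.
  elim: n => [|n IH]; first by rewrite u0 mulr0 mul0r.
  by rewrite uS mulrDr mulrDl mul1r mulr1 {1}IH mulrA.
have [y uy] : exists y, clim u y.
  apply: (@clim_majorant u c (1 - q)^-1).
    elim=> [|n IH].
      by rewrite uS cS u0 c0 mulr0 addr0 !subr0 mulr0 addr0 cnorm1_le1.
    rewrite [X in cnorm X](_ : _ = x * (u n.+1 - u n)); last first.
      by rewrite (uS n.+1) [X in _ - X]uS; ncring.
    rewrite (_ : c _ - _ = q * (c n.+1 - c n)); last first.
      by rewrite (cS n.+1) [X in _ - X]cS; ring.
    by rewrite (le_trans (cnormM _ _)) // ler_wpM2l.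
  elim=> [|n IH]; first by rewrite c0 invr_ge0 subr_ge0 ltW.
  rewrite cS (le_trans (lerD (lexx _) (ler_wpM2l q0 IH))) //.
  have q1 : 1 - q != 0 by rewrite gt_eqF // subr_gt0.
  by rewrite -[X in X + _](divff q1) -mulrDl subrK mul1r.
have yE : y = 1 + x * y.
  apply: (clim_unique (clim_shift uy)).
  by rewrite (funext uS); apply: (climD (clim_cst 1) (climM (clim_cst x) uy)).
have xy := clim_comm uy xu.
exists y; split; first by rewrite mulrBl mul1r {1}yE addrK.
by rewrite mulrBr mulr1 -xy {1}yE addrK.
Qed.

(** A fixed point y of y |-> (h + y^2) / 2 satisfies (1 - y)^2 = 1 - h. Iterate
    this map from 0; as ||h|| <= 1, the real iteration with h replaced by 1,
    which increases and stays in [0, 1], dominates norms and steps. *)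
Lemma sqrt_1B h : star h = h -> cnorm h <= 1 -> exists w, [/\ star w = w,
  w * w = 1 - h, cnorm (1 - w) <= 1 & forall z, z * h = h * z -> z * w = w * z].
Proof.
move=> hs h1.
have [u [u0 uS]] := recursive_seq 0 (fun y => 2^-1%:S * (h + y * y)).
have half_ge0 : 0 <= 2^-1 :> R by rewrite invr_ge0 ler0n.
have [c [c_0 cS]] := recursive_seq 0 (fun r : R => 2^-1 * (1 + r * r)).
have us n : star (u n) = u n.
  elim: n => [|n IH]; first by rewrite u0 star0.
  by rewrite uS starM star_rscal -rscalC starD hs starM IH.
have uC z : z * h = h * z -> forall n, z * u n = u n * z.
  move=> zh; elim=> [|n IH]; first by rewrite u0 mulr0 mul0r.
  by rewrite uS rscalCA mulrDr zh mulrA IH -(mulrA (u n)) IH; ncring.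
have c01 n : 0 <= c n <= 1.
  elim: n => [|n /andP[c0 c1]]; first by rewrite c_0 lexx ler01.
  rewrite cS; nra.
have c0 n : 0 <= c n by case/andP: (c01 n).
have uc n : cnorm (u n) <= c n.
  elim: n => [|n IH]; first by rewrite u0 c_0 cnorm0.
  rewrite uS cS cnorm_rscal ger0_norm // ler_wpM2l //.
  rewrite (le_trans (cnormD _ _)) // lerD // (le_trans (cnormM _ _)) //.
  by rewrite ler_pM ?cnorm_ge0.
have [y uy] : exists y, clim u y.
  apply: (@clim_majorant u c 1) => [|n]; last by case/andP: (c01 n).
  elim=> [|n IH].
    rewrite uS cS u0 c_0 !mulr0 !addr0 !subr0 cnorm_rscal ger0_norm //.
    by rewrite ler_wpM2l.
  rewrite [X in cnorm X](_ : _ =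
    2^-1%:S * (u n.+1 * (u n.+1 - u n) + (u n.+1 - u n) * u n)); last first.
    by rewrite (uS n.+1) [X in _ - X]uS -mulrBr; congr (_ * _); ncring.
  rewrite (_ : c _ - _ =
    2^-1 * (c n.+1 * (c n.+1 - c n) + (c n.+1 - c n) * c n)); last first.
    by rewrite (cS n.+1) [X in _ - X]cS -mulrBr; congr (_ * _); ring.
  rewrite cnorm_rscal ger0_norm // ler_wpM2l //.
  rewrite (le_trans (cnormD _ _)) // lerD // (le_trans (cnormM _ _)) //.
    by rewrite ler_pM ?cnorm_ge0.
  by rewrite ler_pM ?cnorm_ge0.
have yE : 2%:S * y = h + y * y.
  rewrite -[RHS](@rscalK _ _ 2) ?pnatr_eq0 //; congr (_ * _).
  apply: (clim_unique (clim_shift uy)).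
  rewrite (funext uS).
  by apply: (climM (clim_cst _) (climD (clim_cst h) (climM uy uy))).
exists (1 - y); split.
- rewrite starB star1; congr (_ - _); apply: (clim_unique (clim_star uy)).
  by rewrite (_ : star \o u = u) //; apply/funext => n /=.
- have -> : h = 2%:S * y - y * y by rewrite yE addrK.
  rewrite rscal2; ncring.
- rewrite subKr; apply: (clim_norm_le uy) => n.
  by rewrite (le_trans (uc n)) //; case/andP: (c01 n).
- by move=> z zh; rewrite mulrBr mulrBl mulr1 mul1r (clim_comm uy (uC z zh)).
Qed.

End CStarNorm.

(** * Positivity in C*-algebras *)

Section CStarPositivity.
Variables (R : realType) (B : cstarAlgType R).
Implicit Types (x y z h k l v w : B) (t M : R).

Lemma imaginary_unit :
  exists i : B, [/\ forall x, i * x = x * i, i * i = - 1 & star i = - i].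
Proof.
exists (scal 'i); split=> [x||]; first exact: scalC.
  by rewrite -scalM -expr2 sqr_i -rscal1 -rscalN; congr scal; simpc.
rewrite star_scal; apply: (addrI (scal 'i)); rewrite subrr -scalD -rscal0.
by congr scal; apply/eqP; rewrite eq_complex /= addr0 subrr !eqxx.
Qed.

(** For u = k + i l, star u * u = k^2 + l^2, and k is the real part of u. *)
Lemma sq_norm_le k l : star k = k -> star l = l -> k * l = l * k ->
  cnorm k ^+ 2 <= cnorm (k * k + l * l).
Proof.
move=> ks ls kl; have [i [iC ii is_]] := imaginary_unit.
pose u := k + i * l.
have us : star u = k - i * l by rewrite starD starM ks ls is_ mulrN -iC.
have uu : star u * u = k * k + l * l.
  have kil : k * (i * l) = i * l * k by rewrite mulrA -iC -mulrA kl mulrA.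
  have ill : i * l * (i * l) = - (l * l).
    by rewrite mulrA -(mulrA i) -iC !mulrA ii mulN1r mulNr.
  by rewrite us /u mulrBl !mulrDr kil ill; ncring.
have k2 : 2%:S * k = u + star u.
  rewrite us /u rscal2; ncring.
rewrite -uu cnorm_star ler_pXn2r ?nnegrE ?cnorm_ge0 //.
rewrite -(ler_pM2l (ltr0n R 2)) -{1}[2]ger0_norm ?ler0n // -cnorm_rscal k2.
by rewrite (le_trans (cnormD _ _)) // cnorm_star_eq mulr_natl mulr2n.
Qed.

(** 1 - k^2 is the square of a self-adjoint w commuting with k, and the sum of
    the squares of w and k is 1. *)
Lemma cnorm_1B_sq k : star k = k -> cnorm k <= 1 -> cnorm (1 - k * k) <= 1.
Proof.
move=> ks k1; have kks : star (k * k) = k * k by rewrite starM ks.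
have kk1 : cnorm (k * k) <= 1 by rewrite cnorm_sa_sq // expr_le1 ?cnorm_ge0.
have [w [ws ww _ wC]] := sqrt_1B kks kk1.
rewrite -ww cnorm_sa_sq // (le_trans _ (cnorm1_le1 B)) //.
rewrite (le_trans (@sq_norm_le w k ws ks _)) ?ww ?subrK //.
by rewrite -wC // mulrA.
Qed.

Lemma cnorm_rscalB_sq k M : star k = k -> 0 < M -> cnorm (k * k) <= M ->
  cnorm (M%:S - k * k) <= M.
Proof.
move=> ks M0; rewrite cnorm_sa_sq // => kM; pose s : R := Num.sqrt M.
have s0 : 0 < s by rewrite sqrtr_gt0.
have s_ge0 := ltW s0; have M_ge0 := ltW M0.
have sM : s * s = M by rewrite -expr2 sqr_sqrtr // ltW.
have ks1 : cnorm (s^-1%:S * k) <= 1.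
  rewrite cnorm_rscal gtr0_norm ?invr_gt0 // ler_pdivrMl // mulr1.
  by rewrite -(@ler_pXn2r _ 2) ?nnegrE ?cnorm_ge0 // (expr2 s) sM.
rewrite (_ : M%:S - k * k = M%:S * (1 - s^-1%:S * k * (s^-1%:S * k))).
  rewrite cnorm_rscal gtr0_norm // ler_piMr // cnorm_1B_sq //.
  by rewrite starM ks star_rscal -rscalC.
rewrite mulrBr mulr1 -mulrA rscalCA -sM rscalM -(mulrA s%:S).
rewrite (rscalK (s^-1%:S * _)) ?gt_eqF //.
by rewrite rscalK ?gt_eqF.
Qed.

(** Positivity in terms of the norm: the spectrum lies in the disc of centre M
    and radius M. The square root of such an element comes from [sqrt_1B] with
    1 - h / M in place of h. *)
Definition npos h :=
  star h = h /\ exists2 M : R, 0 <= M & cnorm (M%:S - h) <= M.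

Lemma npos_sqrt h : npos h -> exists k, [/\ star k = k, k * k = h, npos k &
  forall z, z * h = h * z -> z * k = k * z].
Proof.
case=> hs [M]; rewrite le_eqVlt => /orP[/eqP <-|M0] hM.
  have -> : h = 0.
    apply/cnorm_eq0/le_anti.
    by rewrite cnorm_ge0 -cnormN -[- h]add0r -rscal0 hM.
  exists 0; split; rewrite ?star0 ?mulr0 //.
  by split; [rewrite star0 | exists 0; rewrite // subr0 rscal0 cnorm0].
pose g := 1 - M^-1%:S * h.
have gs : star g = g by rewrite starB star1 starM hs star_rscal -rscalC.
have g1 : cnorm g <= 1.
  rewrite -(ler_pM2l M0) -{1}[M]gtr0_norm // -cnorm_rscal mulr1.
  by rewrite mulrBr mulr1 rscalK ?gt_eqF.
have [w [ws ww w1 wC]] := sqrt_1B gs g1.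
pose s : R := Num.sqrt M.
have sM : s * s = M by rewrite -expr2 sqr_sqrtr // ltW.
have s0 : 0 <= s by rewrite sqrtr_ge0.
exists (s%:S * w); split.
- by rewrite starM ws star_rscal -rscalC.
- by rewrite -mulrA rscalCA mulrA -rscalM sM ww subKr rscalK ?gt_eqF.
- split; first by rewrite starM ws star_rscal -rscalC.
  exists s => //; rewrite -{1}[s%:S]mulr1 -mulrBr cnorm_rscal ger0_norm //.
  by rewrite ler_piMr.
- move=> z zh; rewrite rscalCA -mulrA; congr (_ * _); apply: wC.
  by rewrite mulrBr mulrBl mulr1 mul1r rscalCA zh mulrA.
Qed.

Lemma npos_sq k : star k = k -> npos (k * k).
Proof.
move=> ks; split; first by rewrite starM ks.
exists (cnorm (k * k) + 1); first by rewrite addr_ge0 ?cnorm_ge0.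
by apply: cnorm_rscalB_sq; rewrite ?ltr_wpDl ?cnorm_ge0 // lerDl.
Qed.

(** The radius M only has to exceed the norm of h; this uniformity is what makes
    the cone closed. *)
Lemma npos_norm h M : npos h -> 0 < M -> cnorm h <= M -> cnorm (M%:S - h) <= M.
Proof. by move=> /npos_sqrt[k [ks <- _ _]]; exact: cnorm_rscalB_sq. Qed.

Lemma npos_cone : spectral_cone npos.
Proof.
split.
- by move=> h [].
- by split; [exact: star1 | exists 1; rewrite // rscal1 subrr cnorm0].
- move=> h k [hs [M M0 hM]] [ks [N N0 kN]]; split; first by rewrite starD hs ks.
  exists (M + N); first exact: addr_ge0.
  by rewrite rscalD opprD addrACA (le_trans (cnormD _ _)) // lerD.
- move=> t h t0 [hs [M M0 hM]]; split.
    by rewrite starM hs star_rscal -rscalC.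
  exists (t * M); first exact: mulr_ge0.
  by rewrite rscalM -mulrBr cnorm_rscal ger0_norm // ler_wpM2l.
- move=> h y ys yh /npos_sqrt[k [ks kh _ kC]].
  have yk : y * k = k * y by apply: kC.
  rewrite -kh (_ : y * _ * y = (k * y) * (k * y)); last first.
    by rewrite (mulrA y) yk -!mulrA.
  by apply: npos_sq; rewrite starM ys ks.
- move=> h hs; exists (cnorm h + 1); first by rewrite ltr_wpDl ?cnorm_ge0.
  split; first by rewrite starB star_rscal hs.
  exists (cnorm h + 1); first by rewrite addr_ge0 ?cnorm_ge0.
  by rewrite subKr lerDl.
- move=> h hP.
  split; first by have [] := hP 1 ltr01; rewrite starD star_rscal => /addIr.
  exists (cnorm h + 1); first by rewrite addr_ge0 ?cnorm_ge0.
  apply/ler_addgt0Pr => e e0; pose t := Num.min 1 (e / 2).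
  have e2 : 0 < e / 2 by rewrite divr_gt0.
  have t0 : 0 < t by rewrite lt_min ltr01.
  have te : t <= e / 2 by rewrite ge_min lexx orbT.
  have hM : cnorm (h + t%:S) <= cnorm h + 1 + t.
    rewrite (le_trans (cnormD _ _)) // -addrA lerD //.
    rewrite (le_trans (cnorm_rscal1 _ _)) //.
    by rewrite gtr0_norm // lerDr.
  have M0 : 0 < cnorm h + 1 + t by rewrite addr_gt0 // ltr_wpDl ?cnorm_ge0.
  have := npos_norm (hP t t0) M0 hM.
  rewrite rscalD opprD addrACA subrr addr0 => /le_trans; apply.
  by rewrite lerD // (le_trans te) // ler_pdivrMr // ler_peMr ?ler1n // ltW.
- move=> t h t0 [_ [M M0 hM]]; have Mt0 : 0 < M + t by rewrite ltr_wpDl.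
  have -> : h = (M + t)%:S * (1 - (M + t)^-1%:S * ((M + t)%:S - h)).
    by rewrite mulrBr rscalK ?gt_eqF // mulr1 subKr.
  apply: invertibleM.
    exists (M + t)^-1%:S.
    by rewrite -!rscalM mulVf ?divff ?gt_eqF // rscal1.
  apply: neumann.
  rewrite cnorm_rscal gtr0_norm ?invr_gt0 // ltr_pdivrMl // mulr1.
  rewrite (le_lt_trans _ (_ : M < _)) ?ltrDl // (le_trans _ hM) //.
  by rewrite rscalD opprB addrA addrAC.
Qed.

(** If h = k^2 and - h = l^2, then [sq_norm_le] bounds ||k||^2 by the norm of
    k^2 + l^2 = 0. *)
Lemma npos_antisym h : npos h -> npos (- h) -> h = 0.
Proof.
move=> /npos_sqrt[k [ks kh _ kC]] /npos_sqrt[l [ls lh _ lC]].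
suff k0 : k = 0 by rewrite -kh k0 mul0r.
apply/cnorm_eq0/eqP; rewrite -sqrf_eq0; apply/eqP/le_anti.
rewrite sqr_ge0 andbT.
rewrite (le_trans (@sq_norm_le k l ks ls _)) ?kh ?lh ?subrr ?cnorm0 //.
by apply: lC; rewrite mulrN mulNr -kh mulrA.
Qed.

(** Test against d = |h| - h, which is twice the negative part of h and is
    positive. From h d = - |h| d it follows that d h d = - 2 h d h is negative,
    so the test gives d h d = 0. As d^3 = - 2 d h d, d vanishes and h = |h|. *)
Lemma npos_test h : star h = h ->
  (forall v, star v = v -> npos (- (v * h * v)) -> v * h * v = 0) -> npos h.
Proof.
move=> hs test.
have [w [ws ww w_pos wC]] := npos_sqrt (npos_sq hs).
have hw : h * w = w * h by apply: wC; rewrite mulrA.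
have [d dE] : exists d, d = w - h by exists (w - h).
have ds : star d = d by rewrite dE starB ws hs.
have dw : d * w = w * d by rewrite dE mulrBl mulrBr hw.
have dd : d * d = 2%:S * (w * d).
  rewrite dE mulrBl !mulrBr hw -ww rscal2; ncring.
have d_pos : npos d.
  apply: (cone_of_invertible npos_cone) => // t t0.
  have [r [wr rw]] : invertible (2%:S * w + t%:S).
    apply: (cone_inv npos_cone t0); rewrite addrK.
    by apply: (coneZ npos_cone) => //; rewrite ler0n.
  have dr : d * r = r * d.
    apply: (comm_inv wr rw); rewrite mulrDr mulrDl rscalCA dw mulrA -rscalC //.
  (* d satisfies d^2 = 2 w d, which inverts d + t formally *)
  have dt : d * d + t%:S * d = d * (2%:S * w + t%:S).
    by rewrite dd mulrDr rscalCA dw (rscalC t).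
  have E : (d + t%:S) * (1 - d * r) = t%:S.
    transitivity (d + t%:S - (d * d + t%:S * d) * r); first by ncring.
    by rewrite dt -mulrA wr mulr1 addrC addKr.
  have E' : (1 - d * r) * (d + t%:S) = t%:S.
    rewrite -[RHS]E mulrBl mulrBr mul1r mulr1; congr (_ - _).
    by rewrite mulrDr mulrDl -rscalC -(mulrA d r) -dr.
  exists (t^-1%:S * (1 - d * r)).
  by rewrite rscalCA -(mulrA t^-1%:S) E E' -rscalM mulVf ?gt_eqF // rscal1.
have wd0 : h * d = - (w * d).
  by apply: (addrI (w * d)); rewrite subrr dE mulrBr mulrBr hw -ww; ncring.
have dh : d * h = h * d by rewrite dE mulrBl mulrBr hw.
pose p := w * (w * d).
have hdh : h * d * h = p.
  by rewrite -mulrA dh wd0 mulrN mulrA hw -mulrA wd0 mulrN opprK.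
have dhd : d * h * d = - (2%:S * p).
  by rewrite -mulrA wd0 mulrN mulrA dw -mulrA dd rscalCA.
have p_pos : npos (2%:S * p).
  apply: (coneZ npos_cone); rewrite ?ler0n // -hdh.
  by apply: (coneJ npos_cone).
have p0 : 2%:S * p = 0.
  by apply/eqP; rewrite -oppr_eq0 -dhd test // dhd opprK.
have d3 : d * d * d = 0.
  by rewrite dd -!mulrA dd rscalCA p0 mulr0.
by move: (sa_cube_eq0 ds d3) => /eqP; rewrite dE subr_eq0 => /eqP <-.
Qed.

(** By [npos_test] it suffices to treat y = x v with star y * y <= 0. Then
    y * star y <= 0 too, since the two products have the same nonzero spectral
    values. But their sum is twice the sum of the squares of the real and
    imaginary parts of y, hence positive, so that star y * y >= 0 as well. *)
Lemma npos_star_sq x : npos (star x * x).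
Proof.
apply: npos_test => [|v vs]; first by rewrite starM starK.
have [y yE] : exists y, y = x * v by exists (x * v).
have -> : v * (star x * x) * v = star y * y by rewrite yE starM vs !mulrA.
move=> yy; have ys : star (star y * y) = star y * y by rewrite starM starK.
suff y_pos : npos (star y * y) by exact: npos_antisym.
have yy' : npos (- (y * star y)).
  apply: (cone_of_invertible npos_cone) => [|t t0].
    by rewrite starN starM starK.
  have [r [yr ry]] : invertible (- (star y * y) + t%:S).
    by apply: (cone_inv npos_cone t0); rewrite addrK.
  set z := star y in yr ry *.
  have E : (- (y * z) + t%:S) * (1 + y * r * z) = t%:S.
    transitivity (t%:S - y * z + (- (y * z * y) + t%:S * y) * r * z).
      by ncring.
    rewrite rscalC.
    transitivity (t%:S - y * z + y * ((- (z * y) + t%:S) * r) * z).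
      by ncring.
    by rewrite yr mulr1 subrK.
  have E' : (1 + y * r * z) * (- (y * z) + t%:S) = t%:S.
    transitivity (t%:S - y * z + y * r * (- (z * y * z) + z * t%:S)).
      by ncring.
    rewrite -rscalC.
    transitivity (t%:S - y * z + y * (r * (- (z * y) + t%:S)) * z).
      by ncring.
    by rewrite ry mulr1 subrK.
  exists (t^-1%:S * (1 + y * r * z)).
  by rewrite rscalCA -(mulrA t^-1%:S) E E' -rscalM mulVf ?gt_eqF // rscal1.
have [i [iC ii is_]] := imaginary_unit.
pose p := y + star y; pose q := i * (y - star y).
have p_pos : npos (p * p) by apply: npos_sq; rewrite starD starK addrC.
have q_pos : npos (q * q).
  by apply: npos_sq; rewrite starM starB starK is_ mulrN -mulNr opprB -iC.
rewrite -[X in npos X](@rscalK _ _ 2^-1) ?invr_eq0 ?pnatr_eq0 // invrK.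
apply: (coneZ npos_cone); first by rewrite invr_ge0 ler0n.
have -> : 2%:S * (star y * y) = p * p + q * q + 2%:S * - (y * star y).
  rewrite /q mulrA -(mulrA i) -iC !mulrA ii rscal2.
  by rewrite /p; ncring.
do !apply: (coneD npos_cone) => //.
by apply: (coneZ npos_cone); rewrite ?ler0n.
Qed.

Lemma nposJ h y : npos h -> npos (star y * h * y).
Proof.
move=> /npos_sqrt[k [ks <- _ _]].
have -> : star y * (k * k) * y = star (k * y) * (k * y).
  by rewrite starM ks !mulrA.
exact: npos_star_sq.
Qed.

End CStarPositivity.

Arguments npos {R B} h.

(** * The operator norm on a von Neumann algebra *)

Section HilbertNorm.
Variables (R : realType) (H : hilbertType R).
Implicit Types (x y z : H) (t : R).

(** The norm of H takes values in R[i]; they are real and nonnegative, so the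
    real part determines them. *)
Definition hnorm x : R := complex.Re `|x|.

Lemma normE x : `|x| = (hnorm x)%:C.
Proof. by rewrite /hnorm RRe_real // normr_real. Qed.

Lemma hnorm_ge0 x : 0 <= hnorm x.
Proof. by rewrite -ler0c -normE. Qed.

Lemma hnorm_eq0 x : hnorm x = 0 -> x = 0.
Proof. by move=> x0; apply/normr0_eq0; rewrite normE x0. Qed.

Lemma hnorm0 : hnorm 0 = 0.
Proof. by rewrite /hnorm normr0. Qed.

Lemma hnormD x y : hnorm (x + y) <= hnorm x + hnorm y.
Proof. by have := ler_normD x y; rewrite !normE -rmorphD lecR. Qed.

Lemma hnormN x : hnorm (- x) = hnorm x.
Proof. by rewrite /hnorm normrN. Qed.

Lemma hnormBC x y : hnorm (x - y) = hnorm (y - x).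
Proof. by rewrite -hnormN opprB. Qed.

Lemma hnormZ (c : R[i]) x : (hnorm (c *: x))%:C = `|c| * (hnorm x)%:C.
Proof. by rewrite -!normE normrZ. Qed.

Lemma hnormZr t x : 0 <= t -> hnorm (t%:C *: x) = t * hnorm x.
Proof.
move=> t0; have := hnormZ t%:C x.
by rewrite ger0_norm ?ler0c // -rmorphM => /complexI.
Qed.

Lemma inner_conj x y : inner x y = Num.conj (inner y x).
Proof. by rewrite hermitian_subproof expr0 mul1r. Qed.

Lemma innerDl x y z : inner (x + y) z = inner x z + inner y z.
Proof. exact: linearDl. Qed.

Lemma innerZl (c : R[i]) x z : inner (c *: x) z = c * inner x z.
Proof. exact: linearZl_LR. Qed.

Definition rinner x y : R := complex.Re (inner x y).

Lemma rinnerC x y : rinner x y = rinner y x.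
Proof. by rewrite /rinner inner_conj; case: (inner y x). Qed.

Lemma rinnerDl x y z : rinner (x + y) z = rinner x z + rinner y z.
Proof. by rewrite /rinner innerDl raddfD. Qed.

Lemma rinnerNl x z : rinner (- x) z = - rinner x z.
Proof. by rewrite /rinner -scaleN1r innerZl mulN1r raddfN. Qed.

Lemma rinnerBl x y z : rinner (x - y) z = rinner x z - rinner y z.
Proof. by rewrite rinnerDl rinnerNl. Qed.

Lemma rinnerZl t x z : rinner (t%:C *: x) z = t * rinner x z.
Proof.
by rewrite /rinner innerZl; case: (inner x z) => a b /=; rewrite mul0r subr0.
Qed.

Lemma rinnerE x : rinner x x = hnorm x ^+ 2.
Proof. by rewrite /rinner inner_norm normE -rmorphXn. Qed.

Lemma hnormB_sq x y :
  hnorm (x - y) ^+ 2 = hnorm x ^+ 2 - 2 * rinner x y + hnorm y ^+ 2.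
Proof.
rewrite -!rinnerE rinnerBl (rinnerC x (_ - _)) (rinnerC y (_ - _)) !rinnerBl.
by rewrite (rinnerC y x); ring.
Qed.

Lemma rinner_le x y : 2 * rinner x y <= hnorm x ^+ 2 + hnorm y ^+ 2.
Proof. by have := hnormB_sq x y; have := sqr_ge0 (hnorm (x - y)); nra. Qed.

End HilbertNorm.

Definition vn_app (R : realType) (H : hilbertType R) (A : vonNeumannAlgebra H)
  (T : A) (x : H) : H := val (val T) x.
Notation "T .@ x" := (vn_app T x) (at level 10).

Section VonNeumann.
Variables (R : realType) (H : hilbertType R) (A : vonNeumannAlgebra H).
Implicit Types (S T : A) (x y : H) (t : R).

Lemma vn_ext S T : (forall x, S .@ x = T .@ x) -> S = T.
Proof. by move=> ST; do 2!apply/val_inj; apply/funext. Qed.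

Lemma vn_appM S T x : (S * T) .@ x = S .@ (T .@ x). Proof. by []. Qed.
Lemma vn_app_addl S T x : (S + T) .@ x = S .@ x + T .@ x. Proof. by []. Qed.
Lemma vn_app_oppl T x : (- T) .@ x = - (T .@ x). Proof. by []. Qed.
Lemma vn_app0l x : (0 : A) .@ x = 0. Proof. by []. Qed.
Lemma vn_app_scal (c : R[i]) x : (scal c : A) .@ x = c *: x. Proof. by []. Qed.

Lemma vn_app_linear T (c : R[i]) x y :
  T .@ (c *: x + y) = c *: (T .@ x) + T .@ y.
Proof. exact: (BHP (val T)).1. Qed.

Lemma vn_appD T x y : T .@ (x + y) = T .@ x + T .@ y.
Proof. by have := vn_app_linear T 1 x y; rewrite !scale1r. Qed.

Lemma vn_app0 T : T .@ 0 = 0.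
Proof. by apply: (addrI (T .@ 0)); rewrite -vn_appD !addr0. Qed.

Lemma vn_appN T x : T .@ (- x) = - (T .@ x).
Proof. by apply: (addrI (T .@ x)); rewrite -vn_appD !subrr vn_app0. Qed.

Lemma vn_app_star T x y : inner (T .@ x) y = inner x (star T .@ y).
Proof. exact: vn_starP. Qed.

Lemma vn_rinner_star T x y : rinner (T .@ x) y = rinner x (star T .@ y).
Proof. by rewrite /rinner vn_app_star. Qed.

Lemma rinner_star_sq T x : rinner ((star T * T) .@ x) x = hnorm (T .@ x) ^+ 2.
Proof. by rewrite vn_appM vn_rinner_star starK rinnerE. Qed.

Definition op_bound T : set R :=
  [set M | 0 <= M /\ forall x, hnorm (T .@ x) <= M * hnorm x].

Definition opnorm T : R := inf (op_bound T).

Lemma op_bound_inf T : has_inf (op_bound T).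
Proof.
split; last by exists 0 => M [].
have [_ [M TM]] := BHP (val T); case: M TM => a b TM; exists `|a|; split=> // x.
have := TM x; rewrite !normE lecE => /andP[_] /=; rewrite mulr0 subr0.
move=> /le_trans; apply.
by rewrite ler_wpM2r ?hnorm_ge0 ?ler_norm.
Qed.

Lemma opnorm_ge0 T : 0 <= opnorm T.
Proof. by apply: lb_le_inf (op_bound_inf T).1 _ => M []. Qed.

Lemma opnormP T x : hnorm (T .@ x) <= opnorm T * hnorm x.
Proof.
have [->|x0] := eqVneq x 0; first by rewrite vn_app0 hnorm0 mulr0.
have x_gt0 : 0 < hnorm x.
  rewrite lt_neqAle hnorm_ge0 andbT eq_sym.
  by apply/eqP => /hnorm_eq0; apply/eqP.
rewrite -ler_pdivrMr //; apply: lb_le_inf (op_bound_inf T).1 _ => M [M0 TM].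
by rewrite ler_pdivrMr.
Qed.

Lemma opnorm_le T t : 0 <= t -> (forall x, hnorm (T .@ x) <= t * hnorm x) ->
  opnorm T <= t.
Proof. by move=> t0 Tt; apply: (ge_inf (op_bound_inf T).2). Qed.

Fact opnorm_eq0 T : opnorm T = 0 -> T = 0.
Proof.
move=> T0; apply: vn_ext => x; rewrite vn_app0l; apply/hnorm_eq0/le_anti.
by rewrite hnorm_ge0 andbT (le_trans (opnormP T x)) // T0 mul0r.
Qed.

Fact opnormD S T : opnorm (S + T) <= opnorm S + opnorm T.
Proof.
apply: opnorm_le => [|x]; first by rewrite addr_ge0 ?opnorm_ge0.
by rewrite vn_app_addl (le_trans (hnormD _ _)) // mulrDl lerD ?opnormP.
Qed.

Fact opnormM S T : opnorm (S * T) <= opnorm S * opnorm T.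
Proof.
apply: opnorm_le => [|x]; first by rewrite mulr_ge0 ?opnorm_ge0.
rewrite vn_appM (le_trans (opnormP _ _)) // -mulrA ler_wpM2l ?opnorm_ge0 //.
exact: opnormP.
Qed.

Fact opnormZ (c : R[i]) T : (opnorm (scal c * T))%:C = `|c| * (opnorm T)%:C.
Proof.
have [r cr] : exists r : R, `|c| = r%:C.
  by exists (complex.Re `|c|); rewrite RRe_real ?normr_real.
have r0 : 0 <= r by rewrite -ler0c -cr.
have hZ x : hnorm (c *: x) = r * hnorm x.
  by apply: (@complexI R); rewrite hnormZ cr rmorphM.
rewrite cr -rmorphM; congr (_%:C); apply/le_anti/andP; split.
  apply: opnorm_le => [|x]; first by rewrite mulr_ge0 ?opnorm_ge0.
  by rewrite vn_appM vn_app_scal hZ -mulrA ler_wpM2l ?opnormP.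
have [->|rn0] := eqVneq r 0; first by rewrite mul0r opnorm_ge0.
have r_gt0 : 0 < r by rewrite lt_neqAle eq_sym rn0.
rewrite -ler_pdivlMl //; apply: opnorm_le => [|x].
  by rewrite mulr_ge0 ?invr_ge0 ?opnorm_ge0.
rewrite -mulrA ler_pdivlMl // -hZ -vn_app_scal -vn_appM; exact: opnormP.
Qed.

Lemma opnorm_star_le T : opnorm (star T) <= opnorm T.
Proof.
set N := opnorm T; have N0 : 0 <= N := opnorm_ge0 T.
apply: opnorm_le => // x; set y := star T .@ x.
have [N_eq0|N_neq0] := eqVneq N 0.
  have T0 : T = 0 by apply: opnorm_eq0.
  by rewrite /y T0 star0 vn_app0l hnorm0 mulr_ge0 ?hnorm_ge0.
have N_gt0 : 0 < N by rewrite lt_neqAle eq_sym N_neq0.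
rewrite -(@ler_pXn2r _ 2) ?nnegrE ?mulr_ge0 ?hnorm_ge0 //.
(* 2 <T y, N^2 x> <= |T y|^2 + |N^2 x|^2 where <T y, x> = |y|^2 *)
have := rinner_le (T .@ y) ((N ^+ 2)%:C *: x).
rewrite rinnerC rinnerZl rinnerC vn_rinner_star rinnerE.
have -> : hnorm ((N ^+ 2)%:C *: x) = N ^+ 2 * hnorm x.
  by rewrite hnormZr // sqr_ge0.
have Ty : hnorm (T .@ y) ^+ 2 <= N ^+ 2 * hnorm y ^+ 2.
  by rewrite -exprMn ler_pXn2r ?nnegrE ?mulr_ge0 ?hnorm_ge0 // opnormP.
move=> le2; have : N ^+ 2 * hnorm y ^+ 2 <= N ^+ 2 * (N * hnorm x) ^+ 2.
  by move: le2 Ty; rewrite !exprMn; nra.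
by rewrite ler_pM2l // exprn_gt0.
Qed.

Fact opnorm_star T : opnorm (star T * T) = opnorm T ^+ 2.
Proof.
have N0 := opnorm_ge0 T; have M0 := opnorm_ge0 (star T * T).
apply/le_anti/andP; split.
  by rewrite (le_trans (opnormM _ _)) // expr2 ler_wpM2r // opnorm_star_le.
rewrite -(ler_sqrt _ M0) sqrtr_sqr ger0_norm //.
apply: opnorm_le => [|x]; first exact: sqrtr_ge0.
rewrite -(@ler_pXn2r _ 2) ?nnegrE ?mulr_ge0 ?hnorm_ge0 ?sqrtr_ge0 //.
rewrite exprMn sqr_sqrtr // -rinner_star_sq.
(* 2 <S x, M x> <= |S x|^2 + |M x|^2 <= 2 M^2 |x|^2 *)
move: (star T * T) M0 => S; set M := opnorm S => M0.
have [M_eq0|M_neq0] := eqVneq M 0.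
  have -> : S = 0 by apply: opnorm_eq0.
  by rewrite vn_app0l /rinner -(scale0r 0) innerZl mul0r M_eq0 mul0r.
have M_gt0 : 0 < M by rewrite lt_neqAle eq_sym M_neq0.
have := rinner_le (S .@ x) (M%:C *: x).
rewrite rinnerC rinnerZl rinnerC hnormZr //.
have Sx : hnorm (S .@ x) ^+ 2 <= (M * hnorm x) ^+ 2.
  by rewrite ler_pXn2r ?nnegrE ?mulr_ge0 ?hnorm_ge0 // opnormP.
move=> le2; rewrite -(ler_pM2l M_gt0); move: le2 Sx; rewrite !exprMn; nra.
Qed.

End VonNeumann.

Lemma initial_cvg (S : choiceType) (T : topologicalType) (f : S -> T)
    (F : set_system S) (s : S) : Filter F -> f @ F --> f s ->
  F --> (s : initial_topology f).
Proof.
move=> FF Fs U [_ [[B Bop <-] Bfs BU]].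
have /Fs : nbhs (f s) B by exact: open_nbhs_nbhs.
by rewrite !nbhs_simpl /= => FB; apply: (filterS BU).
Qed.

Section PointwiseLimits.
Variables (R : realType) (H : hilbertType R) (A : vonNeumannAlgebra H).
Implicit Types (S T : A) (x y : H) (t : R).

Lemma hnorm_cvgP (v : nat -> H) (l : H) :
  v @ \oo --> l <-> (fun n => hnorm (v n - l)) @ \oo --> (0 : R).
Proof.
split=> [vl|vl].
  apply/cvgrPdist_lt => e e0; near=> n.
  rewrite sub0r normrN ger0_norm ?hnorm_ge0 // hnormBC -ltcR -normE.
  near: n; have e0' : (0 : R[i]) < e%:C by rewrite ltcR.
  by move/cvgrPdist_lt : vl => /(_ _ e0').
apply/cvgrPdist_lt => -[e e'] /[dup] + /ltW /ger0_Im /= e'0.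
rewrite {}e'0 complexr0 ltcR => e0.
move/cvgrPdist_lt : vl => /(_ _ e0); apply: filterS => n.
by rewrite sub0r normrN ger0_norm ?hnorm_ge0 // normE ltcR hnormBC.
Unshelve. all: by end_near. Qed.

(** The uniform bound makes the pointwise limit a bounded operator, and strong
    closedness puts it in A. *)
Lemma vn_pointwise_complete (u : nat -> A) (K : R) :
  (forall n x, hnorm (u n .@ x) <= K * hnorm x) ->
  (forall x e, 0 < e -> exists N, forall m n, (N <= n)%N -> (n <= m)%N ->
    hnorm (u m .@ x - u n .@ x) < e) ->
  exists T : A, forall x,
    (fun n => hnorm (u n .@ x - T .@ x)) @ \oo --> (0 : R).
Proof.
move=> uK u_cauchy.
have u_cvg x : cvg ((fun n => u n .@ x) @ \oo).
  apply/cauchy_cvgP/cauchy_exP => -[e e'] /[dup] + /ltW /ger0_Im /= e'0.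
  rewrite {}e'0 complexr0 ltcR => e0.
  have [N NP] := u_cauchy x e e0; exists (u N .@ x); exists N => // n /= Nn.
  by rewrite -ball_normE /= normE ltcR hnormBC NP.
pose f x : H := lim ((fun n => u n .@ x) @ \oo).
have uf x : (fun n => u n .@ x) @ \oo --> f x by exact: u_cvg.
have f_linear : linear f.
  move=> c x y; apply: (cvg_unique _ (uf _)); first exact: norm_hausdorff.
  rewrite /= (funext (fun n => vn_app_linear (u n) c x y)).
  by apply: (cvgD (cvgZl_tmp (uf x)) (uf y)).
have f_bound x : hnorm (f x) <= K * hnorm x.
  rewrite -subr_le0; apply: (cvg_le_const (proj1 (hnorm_cvgP _ _) (uf x))) => n.
  rewrite lerBlDr (le_trans _ (lerD (lexx _) (uK n x))) //.
  by rewrite hnormBC -{1}(subrK (u n .@ x) (f x)) hnormD.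
have fB : f \in @bounded_operators R H.
  apply/asboolP; split=> //; exists K%:C => x.
  by rewrite !normE -rmorphM lecR.
have fA : vn_set A (MkBH fB).
  have uA : \forall n \near \oo, vn_set A (val (u n)).
    by apply: nearW => n; have := valP (u n); rewrite inE.
  apply: (@closed_cvg nat (sot H) \oo _ (fun n => val (u n)) _
    (@vn_closed _ _ A) uA).
  apply: initial_cvg; apply/pointwise_cvgP => x; exact: uf.
exists (MkVN (mem_set fA)) => x.
exact: (proj1 (hnorm_cvgP _ _) (uf x)).
Qed.

Fact opnorm_complete (u : nat -> A) :
  (forall e : R, 0 < e -> exists N : nat,
     forall m n, (N <= m)%N -> (N <= n)%N -> opnorm (u m - u n) < e) ->
  exists T : A, forall e : R, 0 < e -> exists N : nat,
    forall n, (N <= n)%N -> opnorm (u n - T) < e.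
Proof.
move=> u_cauchy.
have [N1 N1P] := u_cauchy 1 ltr01.
pose v n := u (N1 + n)%N.
have vK n x : hnorm (v n .@ x) <= (opnorm (u N1) + 1) * hnorm x.
  rewrite (le_trans (opnormP _ _)) // ler_wpM2r ?hnorm_ge0 //.
  rewrite -[v n](subrKC (u N1)) (le_trans (opnormD _ _)) // lerD // ltW //.
  by rewrite N1P // leq_addr.
have u_x x e m n : opnorm (u m - u n) <= e ->
    hnorm (u m .@ x - u n .@ x) <= e * hnorm x.
  move=> /(ler_wpM2r (hnorm_ge0 x)); apply: le_trans.
  exact: (opnormP (u m - u n)).
have v_cauchy x e : 0 < e -> exists N, forall m n, (N <= n)%N -> (n <= m)%N ->
    hnorm (v m .@ x - v n .@ x) < e.
  move=> e0; have x1 : 0 < hnorm x + 1 by rewrite ltr_wpDl ?hnorm_ge0.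
  have [N NP] := u_cauchy _ (divr_gt0 e0 x1); exists N => m n Nn nm.
  have Nn' : (N <= N1 + n)%N by rewrite (leq_trans Nn) // leq_addl.
  have Nm' : (N <= N1 + m)%N by rewrite (leq_trans Nn') // leq_add2l.
  have le_v := u_x x _ _ _ (ltW (NP _ _ Nm' Nn')).
  by rewrite (le_lt_trans le_v) // mulrAC ltr_pdivrMr // ltr_pM2l // ltrDl.
have [T TP] := vn_pointwise_complete vK v_cauchy.
exists T => e e0; have e2 : 0 < e / 2 by rewrite divr_gt0.
have [N NP] := u_cauchy _ e2; exists N => n Nn.
rewrite (@le_lt_trans _ _ (e / 2)) ?ltr_pdivrMr ?ltr_pMr ?ltr1n //.
apply: opnorm_le => [|x]; first exact: ltW.
rewrite -subr_le0; pose e_ k := hnorm (v (N + k)%N .@ x - T .@ x).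
have e_0 : e_ @ \oo --> (0 : R).
  by have := TP x; rewrite -(cvg_shiftn N) /e_; under eq_fun do rewrite addnC.
apply: (cvg_le_const e_0) => k; rewrite /e_ lerBlDr.
rewrite [X in hnorm X](_ : _ =
    v (N + k)%N .@ x - T .@ x + (u n .@ x - v (N + k)%N .@ x)).
  rewrite (le_trans (hnormD _ _)) // lerD // u_x // ltW // NP //.
  by rewrite (leq_trans (leq_addr k N)) // leq_addl.
by rewrite [RHS]addrC subrKA.
Qed.

End PointwiseLimits.

(** Through this instance square roots, resolvents and the cone [npos] are
    available in A. *)
HB.instance Definition _ (R : realType) (H : hilbertType R)
    (A : vonNeumannAlgebra H) :=
  isCStarAlgebra.Build R (vn_sort A) (@opnorm_eq0 R H A) (@opnormD R H A)
    (@opnormZ R H A) (@opnormM R H A) (@opnorm_star R H A)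
    (@opnorm_complete R H A).

(** * Factorization of the off-diagonal entry of a positive matrix *)

Section Resolvent.
Variables (R : realType) (B : cstarAlgType R).
Implicit Types (a b c r w y : B) (s t : R).

Lemma npos_resolvent a s : npos a -> 0 < s -> exists r,
  [/\ (a + s%:S) * r = 1, r * (a + s%:S) = 1, star r = r & npos r].
Proof.
move=> a_pos s0; have [as_ _] := a_pos.
have Pas : npos (a + s%:S).
  apply: (coneD (npos_cone B)) => //.
  by apply: (cone_rscal (npos_cone B)); exact: ltW.
have [r [ar ra]] : invertible (a + s%:S).
  by apply: (cone_inv (npos_cone B) s0); rewrite addrK.
have rs : star r = r by apply: star_inv ar ra; case: Pas.
exists r; split=> //.
rewrite (_ : r = star r * (a + s%:S) * r); first exact: nposJ.
by rewrite rs ra mul1r.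
Qed.

Lemma resolvent_identity a s t r q : r * (a + t%:S) = 1 -> (a + s%:S) * q = 1 ->
  r = q + (s - t)%:S * (r * q).
Proof.
move=> ra aq.
have : r * ((a + s%:S) * q) - r * (a + t%:S) * q = (s - t)%:S * (r * q).
  rewrite rscalB mulrBl -(rscalCA s r) -(rscalCA t r); ncring.
by rewrite aq ra mulr1 mul1r => <-; rewrite addrC subrK.
Qed.

Variables (a b c w : B).
Hypothesis abc : mx_cone npos (mx22 a c (star c) b).

Lemma mx_cone_diag : npos a /\ npos b.
Proof.
have [_ abcP] := abc; split.
  have := abcP 1 0; rewrite qform_mx22 star1 star0.
  by rewrite !(mulr0, mul0r, addr0, mulr1, mul1r).
have := abcP 0 1; rewrite qform_mx22 star1 star0.
by rewrite !(mulr0, mul0r, add0r, mulr1, mul1r).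
Qed.

Variables (s : R) (r : B).
Hypotheses (s_gt0 : 0 < s) (ar : (a + s%:S) * r = 1) (ra : r * (a + s%:S) = 1).
Hypothesis rs : star r = r.

Let arE : a * r = 1 - s%:S * r.
Proof. by rewrite -ar mulrDl addrK. Qed.

(** The Schur complement is the value of the matrix at the column (- r c, 1),
    increased by s star (r c) * (r c). *)
Lemma schur_npos : npos (b - star c * r * c).
Proof.
have [_ /(_ (- (r * c)) 1)] := abc; rewrite qform_mx22 star1 starN starM rs.
move=> P1; have P2 := coneZ (npos_cone B) (ltW s_gt0) (npos_star_sq (r * c)).
have := coneD (npos_cone B) P1 P2; rewrite starM rs.
congr npos; rewrite mulrN (mulrA a) arE -(rscalCA s (star c * r)); ncring.
Qed.

Hypotheses (ws : star w = w) (ww : w * w = a).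

Let wr : w * r = r * w.
Proof. by apply: comm_inv ar ra _; rewrite mulrDr mulrDl -ww mulrA rscalC. Qed.

(* as r is the inverse of a + s, y approximates the quotient of c by w *)
Let y := r * (w * c).

Let yy : star y * y = star c * r * c - s%:S * (star (r * c) * (r * c)).
Proof.
transitivity (star c * (w * r) * (r * w) * c).
  by rewrite /y !starM ws rs !mulrA.
rewrite wr -{2}wr; transitivity (star c * r * (w * w * r) * c); first by ncring.
by rewrite ww arE starM rs -(rscalCA s (star c * r)); ncring.
Qed.

Lemma root_quotient_bound : npos (b - star y * y).
Proof.
have -> : b - star y * y = b - star c * r * c + s%:S * (star (r * c) * (r * c)).
  by rewrite yy; ncring.
apply: (coneD (npos_cone B)); first exact: schur_npos.
by apply: (coneZ (npos_cone B)); [exact: ltW | exact: npos_star_sq].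
Qed.

Lemma root_quotient_defect : c - w * y = s%:S * (r * c).
Proof.
by rewrite /y !mulrA wr -(mulrA r) ww -[r * a](addrK (r * s%:S)) -mulrDr ra
  mulrBl mul1r subKr -rscalC.
Qed.

Lemma root_quotient_defect_bound :
  npos (s%:S * b - star (c - w * y) * (c - w * y)).
Proof.
have -> : s%:S * b - star (c - w * y) * (c - w * y) =
    s%:S * (b - star c * r * c + star y * y).
  rewrite root_quotient_defect yy starM star_rscal -rscalC -mulrA rscalCA.
  by rewrite -mulrBr; congr (_ * _); ncring.
apply: (coneZ (npos_cone B)); first exact: ltW.
by apply: (coneD (npos_cone B)); [exact: schur_npos | exact: npos_star_sq].
Qed.

End Resolvent.

(** Lowering s to t changes y = q x by d = (s - t) r y, and star y * y by
    star d * d + 2 (s - t) star y * r * y. Hence the squared distance between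
    two approximations is at most the difference of their squares, which turns
    bounded monotone convergence of the squares into strong convergence. *)
Lemma root_quotient_increasing (R : realType) (B : cstarAlgType R)
    (a x r q : B) (s t : R) : t <= s ->
  r * (a + t%:S) = 1 -> (a + s%:S) * q = 1 -> star r = r -> npos r ->
  npos (star (r * x) * (r * x) - star (q * x) * (q * x) -
        star (r * x - q * x) * (r * x - q * x)).
Proof.
move=> ts ra aq rs r_pos.
have -> : r * x = q * x + (s - t)%:S * (r * (q * x)).
  by rewrite {1}(resolvent_identity ra aq) mulrDl -!mulrA.
move: (q * x) => y; set d := (_ * (r * y)).
have -> : star (y + d) * (y + d) - star y * y - star (y + d - y) * (y + d - y) =
    star y * d + star d * y.
  by rewrite (_ : y + d - y = d) ?starD; [ncring | rewrite addrC addKr].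
rewrite /d !starM rs star_rscal -rscalC rscalCA -!mulrA -mulrDr.
apply: (coneZ (npos_cone B)); first by rewrite subr_ge0.
by apply: (coneD (npos_cone B)); rewrite mulrA; exact: nposJ.
Qed.

Section VonNeumannOrder.
Variables (R : realType) (H : hilbertType R) (A : vonNeumannAlgebra H).
Implicit Types (S T : A) (x : H).

Lemma npos_rinner T x : npos T -> 0 <= rinner (T .@ x) x.
Proof.
move=> /npos_sqrt[k [ks <- _ _]].
by rewrite -{1}ks rinner_star_sq sqr_ge0.
Qed.

(** If v T v <= 0, then <v T v x, x> = <T v x, v x> is both nonpositive and
    nonnegative, so the square root of - v T v is zero; apply [npos_test]. *)
Lemma rinner_npos T :
  star T = T -> (forall x, 0 <= rinner (T .@ x) x) -> npos T.
Proof.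
move=> Ts T_ge0; apply: npos_test => // v vs /npos_sqrt[k [ks kk _ _]].
suff k0 : k = 0 by apply/eqP; rewrite -oppr_eq0 -kk k0 mulr0.
apply: vn_ext => x; rewrite vn_app0l; apply/hnorm_eq0/eqP.
rewrite -sqrf_eq0 -rinner_star_sq ks kk; apply/eqP/le_anti/andP; split.
  by rewrite vn_app_oppl rinnerNl oppr_le0 !vn_appM vn_rinner_star vs T_ge0.
by rewrite npos_rinner // -kk; exact: npos_sq.
Qed.

Lemma hnorm_app_le S T x : npos (T - star S * S) ->
  hnorm (S .@ x) ^+ 2 <= rinner (T .@ x) x.
Proof.
move=> /(npos_rinner x); rewrite vn_app_addl vn_app_oppl rinnerBl.
by rewrite rinner_star_sq subr_ge0.
Qed.

(** At a vector x, the squared norms of y_n = (a + s_n)^-1 w c increase and are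
    at most <b x, x>, and by [root_quotient_increasing] their increments
    dominate the squared distances, so y_n converges strongly. With
    s_n = (n + 1)^-2 the defect c - w y_n has norm at most
    <b x, x>^(1/2) / (n + 1) at x. *)
Lemma vn_factorization (a b c : A) : mx_cone npos (mx22 a c (star c) b) ->
  exists w y : A, [/\ star w = w, w * w = a, w * y = c & npos (b - star y * y)].
Proof.
move=> abc; have [a_pos b_pos] := mx_cone_diag abc; have [bs _] := b_pos.
have [w [ws ww _ _]] := npos_sqrt a_pos.
pose h n : R := n.+1%:R^-1; pose s n := h n * h n.
have h_gt0 n : 0 < h n by rewrite invr_gt0 ltr0n.
have s_gt0 n : 0 < s n by rewrite mulr_gt0.
have s_le m n : (n <= m)%N -> s m <= s n.
  move=> nm; have hh : h m <= h n by rewrite lef_pV2 ?posrE ?ltr0n // ler_nat.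
  by rewrite ler_pM // ltW.
have [r rP] := choice (fun n => npos_resolvent a_pos (s_gt0 n)).
pose y n := r n * (w * c).
pose beta x := rinner (b .@ x) x.
have beta_ge0 x : 0 <= beta x by exact: npos_rinner.
have y_le n x : hnorm (y n .@ x) ^+ 2 <= beta x.
  have [ar ra rs _] := rP n; apply: hnorm_app_le.
  exact: (root_quotient_bound abc (s_gt0 n) ar ra rs ws ww).
have y_incr m n x : (n <= m)%N ->
    hnorm (y m .@ x - y n .@ x) ^+ 2 <=
    hnorm (y m .@ x) ^+ 2 - hnorm (y n .@ x) ^+ 2.
  move=> nm; have [_ ra rs r_pos] := rP m; have [aq _ _ _] := rP n.
  have := hnorm_app_le x
    (root_quotient_increasing (w * c) (s_le _ _ nm) ra aq rs r_pos).
  by rewrite vn_app_addl vn_app_oppl rinnerBl !rinner_star_sq.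
have [K K0 bK] := cone_bound (npos_cone _) bs.
have y_bound n x : hnorm (y n .@ x) <= Num.sqrt K * hnorm x.
  rewrite -(@ler_pXn2r _ 2) ?nnegrE ?mulr_ge0 ?hnorm_ge0 ?sqrtr_ge0 //.
  rewrite exprMn sqr_sqrtr ?(ltW K0) // (le_trans (y_le n x)) //.
  have := npos_rinner x bK; rewrite vn_app_addl vn_app_oppl rinnerBl.
  by rewrite vn_app_scal rinnerZl rinnerE subr_ge0.
have [z zP] : exists z : A, forall x,
    (fun n => hnorm (y n .@ x - z .@ x)) @ \oo --> (0 : R).
  apply: (vn_pointwise_complete y_bound) => x e e0.
  have g_incr n : hnorm (y n .@ x) ^+ 2 <= hnorm (y n.+1 .@ x) ^+ 2.
    by rewrite -subr_ge0 (le_trans _ (y_incr _ _ _ (leqnSn n))) ?sqr_ge0.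
  have e2_gt0 : 0 < e ^+ 2 by rewrite exprn_gt0.
  have [N NP] := nondecreasing_bounded_cauchy g_incr (y_le ^~ x) e2_gt0.
  exists N => m n Nn nm; have /andP[_ lt_e] := NP m n Nn nm.
  rewrite -(@ltr_pXn2r _ 2) ?nnegrE ?hnorm_ge0 ?(ltW e0) //.
  exact: le_lt_trans (y_incr _ _ _ nm) lt_e.
exists w, z; split=> //.
- apply: vn_ext => x; apply/eqP; rewrite -subr_eq0; apply/eqP/hnorm_eq0/le_anti.
  rewrite hnorm_ge0 andbT.
  apply: (cvg_le_const (e := fun n => hnorm (y n .@ x - z .@ x) * opnorm w +
    h n * Num.sqrt (beta x))) => [|n].
    have -> : 0 = 0 * opnorm w + 0 * Num.sqrt (beta x) by rewrite !mul0r addr0.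
    apply: cvgD; first exact: cvgMr_tmp (zP x).
    by apply: cvgMr_tmp; exact: cvg_harmonic.
  have -> : (w * z) .@ x - c .@ x =
      - (w .@ (y n .@ x - z .@ x)) - ((c - w * y n) .@ x).
    rewrite vn_appD vn_appN vn_app_addl vn_app_oppl !vn_appM.
    by rewrite opprB opprB addrA subrK.
  rewrite (le_trans (hnormD _ _)) // !hnormN lerD //.
    by rewrite mulrC opnormP.
  have [ar ra rs _] := rP n.
  have h_ge0 := ltW (h_gt0 n).
  rewrite -(@ler_pXn2r _ 2) ?nnegrE ?mulr_ge0 ?hnorm_ge0 ?sqrtr_ge0 //.
  rewrite exprMn sqr_sqrtr // expr2.
  have := hnorm_app_le x
    (root_quotient_defect_bound abc (s_gt0 n) ar ra rs ws ww).
  by rewrite vn_appM vn_app_scal rinnerZl.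
- apply: rinner_npos => [|x]; first by rewrite starB starM starK bs.
  rewrite vn_app_addl vn_app_oppl rinnerBl rinner_star_sq subr_ge0 -/(beta x).
  rewrite -[leRHS]sqr_sqrtr // ler_pXn2r ?nnegrE ?hnorm_ge0 ?sqrtr_ge0 //.
  rewrite -subr_le0; apply: (cvg_le_const (zP x)) => n.
  rewrite lerBlDr hnormBC -{1}(subrK (y n .@ x) (z .@ x)).
  rewrite (le_trans (hnormD _ _)) // lerD //.
  rewrite -(@ler_pXn2r _ 2) ?nnegrE ?hnorm_ge0 ?sqrtr_ge0 // sqr_sqrtr //.
Qed.

End VonNeumannOrder.

(** * Lieb maps *)

Lemma npos_positive (R : realType) (B : cstarAlgType R) (h : B) :
  npos h <-> positive h.
Proof. exact: (cone_positive (npos_cone B)). Qed.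

Lemma mx_npos_positive (R : realType) (B : cstarAlgType R) (M : 'M[B]_2) :
  mx_cone npos M <-> positive M.
Proof.
exact: (cone_positive (spectral_cone_mx (npos_cone B) (@nposJ R B))).
Qed.

Section ConcreteMatrices.
Variables (R : realType) (B : cstarAlgType R).
Implicit Types (a b d : B).

Lemma mx_npos_corner d : npos d -> mx_cone npos (mx22 0 0 0 d).
Proof.
move=> d_pos; have [ds _] := d_pos; split=> [|x y].
  by rewrite star_mx22 !star0 ds.
by rewrite qform_mx22 !mul0r addr0 mulr0 !add0r mulrA; exact: nposJ.
Qed.

Lemma mx_npos_gram a b :
  mx_cone npos
    (mx22 (star a * a) (star a * b) (star (star a * b)) (star b * b)).
Proof.
split=> [|x y]; first by rewrite star_mx22 !starM !starK.
rewrite qform_mx22.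
rewrite [X in npos X](_ : _ = star (a * x + b * y) * (a * x + b * y)).
  exact: npos_star_sq.
by rewrite starD !starM starK; ncring.
Qed.

Lemma mx_npos_le a b :
  npos b -> npos (a - b) -> mx_cone npos (mx22 a b (star b) b).
Proof.
move=> b_pos ab_pos; have [bs _] := b_pos.
have as_ : star a = a.
  by have [] := coneD (npos_cone B) ab_pos b_pos; rewrite subrK.
split=> [|x y]; first by rewrite star_mx22 !bs as_.
rewrite bs qform_mx22.
rewrite [X in npos X](_ : _ =
    star x * (a - b) * x + star (x + y) * b * (x + y)).
  by apply: (coneD (npos_cone B)); exact: nposJ.
by rewrite starD; ncring.
Qed.

(** a - b is the value at the column (1, -1). *)
Lemma le_mx_npos a b : mx_cone npos (mx22 a b (star b) b) -> npos (a - b).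
Proof.
move=> [abs /(_ 1 (- 1))]; move: abs; rewrite star_mx22 => /mx22_inj[_ _ _ bs].
rewrite bs qform_mx22 starN star1; congr npos; ncring.
Qed.

End ConcreteMatrices.

Theorem proposition2p4 (R : realType) (H : hilbertType R)
    (A : vonNeumannAlgebra H) (B : cstarAlgType R) (Phi : A -> B) :
  Lieb_map Phi <->
  (forall a b c : A,
     positive (mx22 a c (star c) b) ->
     positive (mx22 (Phi a) (Phi c) (star (Phi c)) (Phi b))).
Proof.
split=> [[Phi_mono Phi_CS] a b c | Phi_mx].
  move=> /mx_npos_positive/vn_factorization[w [y [ws ww wy by_pos]]].
  have yy_pos : positive (star y * y) by exact/npos_positive/npos_star_sq.
  have /npos_positive/mx_npos_corner d_pos :=
    Phi_mono b _ yy_pos ((npos_positive _).1 by_pos).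
  have /mx_npos_positive := Phi_CS w y; rewrite ws ww wy => CS.
  apply/mx_npos_positive.
  have := coneD (spectral_cone_mx (npos_cone B) (@nposJ R B)) CS d_pos.
  by rewrite add_mx22 !addr0 subrKC.
split=> [a b /npos_positive b_pos /npos_positive ab_pos | a b].
  apply/npos_positive/le_mx_npos/mx_npos_positive/Phi_mx/mx_npos_positive.
  exact: mx_npos_le.
exact/Phi_mx/mx_npos_positive/mx_npos_gram.
Qed.
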